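(* Let $K$ be a field and let $I\subset S=K[x_1,\ldots,x_n]$ be a polymatroidal ideal. Then $$\operatorname{astab}(I)<\ell(I)\quad\text{and}\quad \operatorname{dstab}(I)<\ell(I).$$ In particular, $\operatorname{astab}(I)<n$ and $\operatorname{dstab}(I)<n$.
   Context: The set of bases of a polymatroid of rank $d$ based on $[n]=\{1,\ldots,n\}$ is a (nonempty) set $\mathcal B\subset\mathbb Z^n$ of integer vectors $\mathbf a=(a(1),\ldots,a(n))$ with non-negative entries such that: (i) $\sum_{i=1}^n a(i)=d$ for all $\mathbf a\in\mathcal B$; (ii) (exchange property) for all $\mathbf a,\mathbf b\in\mathcal B$ and all $i$ with $a(i)>b(i)$ there exists $j\in[n]$ with $b(j)>a(j)$ and $\mathbf a-\epsilon_i+\epsilon_j\in\mathcal B$, where $\epsilon_i$ is the $i$-th canonical unit vector. For a monomial ideal $I$, $G(I)$ denotes its unique minimal set of monomial generators. A monomial ideal $I\subset S$ is polymatroidal if there is a set of bases $\mathcal B\subset \mathbb Z^n$ of a polymatroid with $G(I)=\{\mathbf x^{\mathbf a}: \mathbf a\in\mathcal B\}$, where $\mathbf x^{\mathbf a}=x_1^{a(1)}\cdots x_n^{a(n)}$. Ideals are assumed to be proper. $\operatorname{Ass}(I)$ denotes the set of associated prime ideals of $S/I$. The index of stability for the associated prime ideals of the powers of $I$ is $$\operatorname{astab}(I)=\min\{k : \operatorname{Ass}(I^\ell)=\operatorname{Ass}(I^k)\text{ for all }\ell\ge k\},$$ and the index of depth stability of $I$ is $$\operatorname{dstab}(I)=\min\{k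 : \operatorname{depth} S/I^\ell=\operatorname{depth} S/I^k\text{ for all }\ell\ge k\},$$ where $k$ ranges over the positive integers. The analytic spread $\ell(I)$ is the Krull dimension of $\mathcal R(I)/\mathfrak m\mathcal R(I)$, where $\mathcal R(I)=\bigoplus_{k\ge0}I^k$ is the Rees ring and $\mathfrak m=(x_1,\ldots,x_n)$.
   Formalization: The formal theorem assumes in addition that I is not principal; for a principal polymatroidal ideal, e.g. I = (x_1) in K[x_1], astab(I) = dstab(I) = ℓ(I) = 1, so the strict inequalities fail. *)

(* Defs.v *)
From HB Require Import structures.
From mathcomp Require Import all_boot all_order all_algebra ring_quotient.
From mathcomp Require Import boolp.
From mathcomp Require Import mpoly.

Set Implicit Arguments.
Unset Strict Implicit.
Unset Printing Implicit Defensive.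

Import GRing.Theory.
Local Open Scope ring_scope.

Definition is_min (Q : nat -> Prop) (k : nat) : Prop :=
  Q k /\ forall j, Q j -> (k <= j)%N.

Definition is_max (Q : nat -> Prop) (k : nat) : Prop :=
  Q k /\ forall j, Q j -> (j <= k)%N.

(* Ideals are boolean predicates, as in ring_quotient; since boolp makes every
   proposition decidable, these are arbitrary subsets of the ring. *)
Section Ideals.
Variable R : comNzRingType.
Implicit Types (G I J M P : {pred R}) (f g : R) (k : nat).

Definition ideal_gen G : {pred R} := fun p =>
  `[< exists2 s : seq (R * R),
        {in s, forall cg, cg.2 \in G} & p = \sum_(cg <- s) cg.1 * cg.2 >].

(* For a nonzero proper principal ideal of K[x_1, ..., x_n], both indices of
   stability and the analytic spread equal 1, so strict inequality fails. *)
Definition principal I : Prop := exists f, I =i ideal_gen (pred1 f).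

(* The ideal generated by all k-fold products; for k = 0 it is the whole ring. *)
Definition ideal_pow I k : {pred R} :=
  ideal_gen (fun p =>
    `[< exists s : seq R,
          [/\ size s = k, {subset s <= I} & p = \prod_(f <- s) f] >]).

(* idealr_closed includes properness. *)
Definition prime_ideal P : Prop := idealr_closed P /\ prime_idealr_closed P.

(* P = Ann(f + J) for some f + J in R/J. *)
Definition associated_prime J P : Prop :=
  prime_ideal P /\ exists f, forall g, g \in P = (g * f \in J).

Definition ideal_chain (c : nat -> {pred R}) (d : nat) : Prop :=
  (forall i, (i <= d)%N -> prime_ideal (c i)) /\
  (forall i, (i < d)%N ->
     {subset c i <= c i.+1} /\ ~ {subset c i.+1 <= c i}).

Definition krull_dim : nat -> Prop :=
  is_max (fun d => exists c, ideal_chain c d).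

(* J + (fs) *)
Definition ideal_add J (fs : seq R) : {pred R} :=
  ideal_gen [pred g | (g \in J) || (g \in fs)].

(* fs is an R/J-regular sequence contained in M. *)
Definition regular_seq M J (fs : seq R) : Prop :=
  [/\ {subset fs <= M},
      1 \notin ideal_add J fs
    & forall i, (i < size fs)%N -> forall g,
        fs`_i * g \in ideal_add J (take i fs) -> g \in ideal_add J (take i fs)].

Definition is_astab I : nat -> Prop :=
  is_min (fun k => (0 < k)%N /\ forall l, (k <= l)%N -> forall P,
            associated_prime (ideal_pow I l) P <->
            associated_prime (ideal_pow I k) P).

Lemma ideal_gen_sub G : {subset G <= ideal_gen G}.
Proof.
move=> g Gg; apply/asboolP; exists [:: (1, g)].
  by move=> cg; rewrite inE => /eqP->.
by rewrite big_seq1 mul1r.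
Qed.

Lemma ideal_gen0 G : 0 \in ideal_gen G.
Proof. by apply/asboolP; exists [::]; rewrite ?big_nil. Qed.

Lemma ideal_genD G : {in ideal_gen G &, forall u v, u + v \in ideal_gen G}.
Proof.
move=> u v /asboolP[s sG ->] /asboolP[t tG ->]; apply/asboolP.
exists (s ++ t); last by rewrite big_cat.
by move=> cg; rewrite mem_cat => /orP[/sG|/tG].
Qed.

Lemma ideal_genMl G a : {in ideal_gen G, forall u, a * u \in ideal_gen G}.
Proof.
move=> u /asboolP[s sG ->]; apply/asboolP.
exists [seq (a * cg.1, cg.2) | cg <- s].
  by move=> _ /mapP[cg /sG cgG ->].
by rewrite big_map mulr_sumr; apply: eq_bigr => cg _; rewrite mulrA.
Qed.

Lemma ideal_gen_sum G (T : Type) (s : seq T) (A : pred T) (F : T -> R) :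
  (forall t, A t -> F t \in ideal_gen G) ->
  \sum_(t <- s | A t) F t \in ideal_gen G.
Proof.
move=> FG; elim/big_ind: _ => //; first exact: ideal_gen0.
by move=> u v; apply: ideal_genD.
Qed.

Lemma ideal_pow_mul I k l f g :
  f \in ideal_pow I k -> g \in ideal_pow I l -> f * g \in ideal_pow I (k + l).
Proof.
move=> /asboolP[s sG ->] /asboolP[t tG ->]; rewrite mulr_suml big_seq.
apply: ideal_gen_sum => cg /sG /asboolP[a [<- aI ->]].
rewrite mulr_sumr big_seq; apply: ideal_gen_sum => dh /tG /asboolP[b [<- bI ->]].
rewrite mulrACA; apply: ideal_genMl; apply: ideal_gen_sub.
apply/asboolP; exists (a ++ b); split; [by rewrite size_cat | | by rewrite big_cat].
by move=> x; rewrite mem_cat => /orP[/aI|/bI].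
Qed.

Lemma ideal_pow0 I f : f \in ideal_pow I 0.
Proof.
rewrite -[f]mulr1; apply: ideal_genMl; apply: ideal_gen_sub.
by apply/asboolP; exists [::]; split=> //; rewrite big_nil.
Qed.

(* The Rees ring \bigoplus_k I^k, realised inside R[t] as the ring of
   polynomials whose coefficient of t^k lies in I^k. *)
Definition rees_pred I : {pred {poly R}} := fun p =>
  `[< forall k, p`_k \in ideal_pow I k >].

Lemma rees_subring I : GRing.subring_closed (rees_pred I).
Proof.
split.
- apply/asboolP => -[|k]; first exact: ideal_pow0.
  by rewrite coef1; apply: ideal_gen0.
- move=> p q /asboolP Ip /asboolP Iq; apply/asboolP => k.
  rewrite coefB -mulN1r; apply: ideal_genD; first exact: Ip.
  by apply: ideal_genMl; apply: Iq.
- move=> p q /asboolP Ip /asboolP Iq; apply/asboolP => k.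
  rewrite coefM; apply: ideal_gen_sum => i _.
  have := ideal_pow_mul (Ip i) (Iq (k - i)%N).
  by rewrite (subnKC (leq_ord i)).
Qed.

HB.instance Definition _ I :=
  GRing.isSubringClosed.Build {poly R} (rees_pred I) (rees_subring I).

Record rees I := Rees { rees_val : {poly R}; _ : rees_val \in rees_pred I }.

HB.instance Definition _ I := [isSub for @rees_val I].
HB.instance Definition _ I := [Choice of rees I by <:].
HB.instance Definition _ I := [SubChoice_isSubComNzRing of rees I by <:].

End Ideals.

(* The extension M R(I) of M along R = I^0 -> R(I). *)
Definition rees_ext (R : comNzRingType) (M I : {pred R}) : {pred rees I} :=
  ideal_gen (fun p : rees I => `[< exists2 c, c \in M & val p = c%:P >]).

Arguments rees_ext {R} M I _.

Section PolynomialRing.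
Variables (K : fieldType) (n : nat).
Local Notation S := {mpoly K[n]}.
Implicit Types (I J : {pred S}) (B : {pred 'X_{1..n}}).

Definition mmax : {pred S} := ideal_gen [pred p | [exists i : 'I_n, p == 'X_i]].

Definition depth_quot J : nat -> Prop :=
  is_max (fun r => exists2 fs : seq S, size fs = r & regular_seq mmax J fs).

Definition is_dstab I : nat -> Prop :=
  is_min (fun k => (0 < k)%N /\ forall l, (k <= l)%N -> exists r,
            depth_quot (ideal_pow I l) r /\ depth_quot (ideal_pow I k) r).

Definition mfiber I : {pred rees I} := rees_ext mmax I.

Arguments mfiber I _ : clear implicits.

Lemma mmax_coef0 p : p \in mmax -> p@_0%MM = 0.
Proof.
move=> /asboolP[s sG ->]; rewrite raddf_sum big_seq big1 // => cg /sG.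
rewrite inE => /existsP[i /eqP->].
by rewrite [LHS](rmorphM (mcoeff 0%MM)) /= mcoeffX mnm1_eq0 mulr0.
Qed.

Lemma mfiber_ideal I : idealr_closed (mfiber I).
Proof.
split; first exact: ideal_gen0; last first.
  by move=> a u v Iu Iv; apply: ideal_genD => //; apply: ideal_genMl.
apply/negP => /asboolP[s sG /(congr1 (fun p : rees I => (val p)`_0 @_0%MM))].
rewrite rmorph1 coef1 eqxx mcoeff1 eqxx rmorph_sum coef_sum raddf_sum /=.
rewrite big_seq big1 => [/eqP|cg /sG]; first by rewrite oner_eq0.
move=> /asboolP[c /mmax_coef0 c0 e].
by rewrite e coefMC [LHS](rmorphM (mcoeff 0%MM)) /= c0 mulr0.
Qed.

HB.instance Definition _ I :=
  isIdealr.Build (rees I) (mfiber I) (@mfiber_ideal I).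

Definition analytic_spread I : nat -> Prop :=
  krull_dim {ideal_quot (mfiber I)}.

Definition polymatroid_bases B : Prop :=
  [/\ exists a, a \in B,
      exists d, forall a, a \in B -> mdeg a = d
    & forall a b : 'X_{1..n}, a \in B -> b \in B ->
        forall i, (b i < a i)%N ->
        exists2 j, (a j < b j)%N & (a - U_(i) + U_(j))%MM \in B].

Definition monomials B : {pred S} := fun p =>
  `[< exists2 a, a \in B & p = 'X_[a] >].

(* The monomials x^a, a in B, form a minimal generating set: G(I) = x^B. *)
Definition minimal_monomial_generators I B : Prop :=
  I =i ideal_gen (monomials B) /\
  forall B', {subset B' <= B} -> I =i ideal_gen (monomials B') -> B' =i B.

Definition polymatroidal I : Prop :=
  exists2 B, polymatroid_bases B & minimal_monomial_generators I B.

End PolynomialRing.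

Arguments mfiber {K n} I _.

(* Main.v *)
(* Write B for the set of exponents of G(I), lB for its l-fold sumset, and c for the
   number of connected components of the graph on [n] joining i and j when
   q + e_i and q + e_j both lie in B for some q. Then k0 = n - c bounds both
   indices of stability, and the analytic spread is at least k0 + 1.

   Associated primes: a monomial prime P_A is associated to I^l iff the
   localization of B at A (the restrictions to A of the bases of minimal weight
   on A) satisfies: there is w with w + e_j in its l-fold sumset for all j in A.
   The exchange property makes the localization connected on A, and conversely
   connectedness on A yields such a w for every l >= max(1, |A| - 1), by adding
   one vertex at a time; moreover |A| - 1 <= k0.

   Depth: fix a representative y of each component. The differences
   x_y - x_(y1) form a regular sequence on S/I^l, because bases can be mixed along
   components; modulo this sequence, B becomes connected on n - c + 1 vertices,
   which gives a socle element as soon as l >= k0. Koszul homology shows that no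
   regular sequence in m is longer, so depth S/I^l = c - 1 for all l >= k0.

   Spread: a positive weight w with minimum v on B gives a prime of the Rees ring
   containing (x_1, ..., x_n), spanned by the c x^u t^k with w(u) > k v; a flag of
   faces through a vertex of the base polytope gives a chain of k0 + 2 such primes.
   Chains have length at most n because the fiber ring embeds into S, where n + 1
   elements are algebraically dependent. *)
From HB Require Import structures.
Require Import Defs.
From mathcomp Require Import all_boot all_order all_algebra generic_quotient.
From mathcomp Require Import ring_quotient boolp mpoly zify ring.

Set Implicit Arguments.
Unset Strict Implicit.
Unset Printing Implicit Defensive.

Import GRing.Theory.

(** * Discrete polymatroids and their sumsets *)

Section Weights.
Variable n : nat.
Implicit Types (a b c m q : 'X_{1..n}) (w : 'I_n -> nat).

Definition wt w a : nat := \sum_i w i * a i.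

Lemma wtD w a b : wt w (a + b)%MM = wt w a + wt w b.
Proof. by rewrite -big_split; apply: eq_bigr => i _; rewrite mnmDE mulnDr. Qed.

Lemma wtU w i : wt w U_(i)%MM = w i.
Proof.
rewrite /wt (bigD1 i) //= mnm1E eqxx muln1 big1 ?addn0 // => j ji.
by rewrite mnm1E eq_sym (negbTE ji) muln0.
Qed.

Lemma wt0 w : wt w 0%MM = 0.
Proof. by rewrite /wt big1 // => i _; rewrite mnm0E muln0. Qed.

Lemma wt1 a : wt (fun=> 1) a = mdeg a.
Proof. by rewrite mdegE; apply: eq_bigr => i _; rewrite mul1n. Qed.

Lemma leq_wt w a b : (forall i, w i = 0 \/ a i <= b i) -> wt w a <= wt w b.
Proof.
by move=> le; apply: leq_sum => i _; case: (le i) => [->//|h]; rewrite leq_mul2l h orbT.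
Qed.

Lemma wt_lem w a b : (a <= b)%MM -> wt w a <= wt w b.
Proof. by move=> /mnm_lepP le; apply: leq_wt => i; right. Qed.

Lemma mnmU a i : 0 < a i -> (a - U_(i) + U_(i))%MM = a.
Proof.
move=> ai; apply/mnmP => j; rewrite mnmDE mnmBE mnm1E.
by case: eqP => [<-|_] /=; lia.
Qed.

(** Subtraction of exponents is truncated: if [a i] is zero, only [U_(j)] is added and the degree
    rises by one. A true exchange needs [0 < a i]. *)
Definition move a i j : 'X_{1..n} := (a - U_(i) + U_(j))%MM.

Lemma moveE a i j k : move a i j k = a k - (i == k) + (j == k).
Proof. by rewrite /move mnmDE mnmBE !mnm1E. Qed.

Lemma wt_move w a i j : 0 < a i -> wt w (move a i j) + w i = wt w a + w j.
Proof.
by move=> ai; rewrite -[in RHS](mnmU ai) !wtD !wtU; lia.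
Qed.

(** For vectors of equal degree this is half the L1 distance; it is the induction measure for
    repeated exchanges. *)
Definition mdist a b : nat := \sum_i (a i - b i).

Lemma ltn_mdist a a' b i :
  (forall k, a' k - b k <= a k - b k) -> a' i - b i < a i - b i ->
  mdist a' b < mdist a b.
Proof.
move=> le lt; rewrite /mdist (bigD1 i) //= [ltnRHS](bigD1 i) //=.
by rewrite -addSn; apply: leq_add => //; apply: leq_sum.
Qed.

Lemma mdist_move a b i j : b i < a i -> a j < b j ->
  mdist (move a i j) b < mdist a b.
Proof.
move=> ai bj; apply: (ltn_mdist (i := i)) => [k|]; rewrite moveE; last first.
  by rewrite eqxx; case: eqP => [e|]; [rewrite e in bj|]; lia.
by case: (j =P k) => [<-|_]; case: (i =P _) => [e|_]; lia.
Qed.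

Lemma excess w a b : wt w a < wt w b -> exists2 i, 0 < w i & a i < b i.
Proof.
move=> lt; apply/exists2P; apply: contrapT => /forallNP h.
suff: wt w b <= wt w a by lia.
apply: leq_wt => i; case: (posnP (w i)) => [->|wi]; first by left.
by right; rewrite leqNgt; apply/negP => lti; apply: (h i).
Qed.

Lemma mnm_eq_or_lt a b : mdeg a = mdeg b -> a = b \/ exists i, b i < a i.
Proof.
move=> ab; case: (pselect (exists i, b i < a i)) => [|/forallNP h]; first by right.
left; have le i : a i <= b i by rewrite leqNgt; apply/negP/h.
have h2 i : ~ (a i < b i).
  move=> lt; suff: mdeg a < mdeg b by lia.
  rewrite !mdegE (bigD1 i) //= [ltnRHS](bigD1 i) //= -addSn.
  by apply: leq_add => //; apply: leq_sum.
by apply/mnmP => i; have := le i; have /negP := h2 i; lia.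
Qed.

End Weights.

(** * Exchange property, sumsets and connectedness *)

Section MConvex.
Variables (n : nat).
Implicit Types (a b c m q : 'X_{1..n}) (w : 'I_n -> nat) (B C : 'X_{1..n} -> Prop).

Definition equigenerated d B := forall a, B a -> mdeg a = d.

Definition exchange B := forall a b, B a -> B b -> forall i, b i < a i ->
  exists2 j, a j < b j & B (move a i j).

Definition adj B i j := exists2 q, B (q + U_(i))%MM & B (q + U_(j))%MM.

Lemma adj_sym B i j : adj B i j -> adj B j i.
Proof. by case=> q; exists q. Qed.

Lemma adj_move B a i j : 0 < a i -> B a -> B (move a i j) -> adj B i j.
Proof. by move=> ai Ba Bm; exists (a - U_(i))%MM; rewrite ?mnmU. Qed.

Lemma equigen_move d B a i j : equigenerated d B -> B a -> B (move a i j) -> 0 < a i.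
Proof.
move=> hd Ba Bm; have := hd _ Bm; have := hd _ Ba.
case: (posnP (a i)) => // a0 <-; rewrite /move.
have -> : (a - U_(i))%MM = a.
  by apply/mnmP => k; rewrite mnmBE mnm1E; case: eqP => [<-|]; lia.
by rewrite mdegD mdeg1; lia.
Qed.

Section OneSet.
Variables (d : nat) (B : 'X_{1..n} -> Prop).
Hypotheses (Bd : equigenerated d B) (Bx : exchange B).

(** Here the coordinate to be raised is prescribed. The exchange property pulls [b] towards [a]
    while keeping an excess at [i]; at the end [b] exceeds [a] only at [i], by one unit, and
    equality of degrees makes [b] the required move. *)
Lemma dual_exchange a b : B a -> B b -> forall i, a i < b i ->
  exists2 j, b j < a j & B (move a j i).
Proof.
move=> Ba Bb i abi.
have [N] := ubnP (mdist b a); elim: N b Bb abi => // N IH b Bb abi bN.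
have step k : a k < b k -> a i < (b i - (k == i)) ->
    exists2 j, b j < a j & B (move a j i).
  move=> abk h; have [j abj Bm] := Bx Bb Ba abk.
  have [||j' lj Bj] := IH _ Bm.
  - by rewrite moveE; lia.
  - by have := mdist_move abk abj; lia.
  exists j' => //; move: lj; rewrite moveE; case: (j =P j') => [<-|_]; first by lia.
  by case: (k =P j') => [ek|_]; [rewrite ek in abk|]; lia.
case: (pselect (exists2 k, k != i & a k < b k)) => [[k ki abk]|h].
  by apply: (step k) => //; rewrite (negbTE ki) subn0.
case: (ltnP (a i).+1 (b i)) => [lt|le].
  by apply: (step i) => //; rewrite eqxx; lia.
have le1 k : k != i -> b k <= a k.
  by move=> ki; rewrite leqNgt; apply/negP => lt; apply: h; exists k.
have : mdeg b = mdeg a by rewrite (Bd Ba) (Bd Bb).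
have [j bj] : exists j, b j < a j.
  have [|e|//] := @mnm_eq_or_lt _ a b; first by rewrite (Bd Ba) (Bd Bb).
  by move: abi; rewrite e ltnn.
move=> deg; exists j => //; suff <- : b = move a j i by [].
have ji : j != i by apply/eqP => e; move: bj abi; rewrite e; lia.
have lec : (b <= move a j i)%MM.
  apply/mnm_lepP => k; rewrite moveE.
  case: (i =P k) => [<-|/eqP]; first by rewrite (negbTE ji); lia.
  by rewrite eq_sym => /le1 {}h; case: (j =P k) => [<-|_]; lia.
have degm : mdeg (move a j i) = mdeg b.
  by rewrite deg -!wt1; have := @wt_move _ (fun=> 1) a j i; lia.
have [//|[k]] := mnm_eq_or_lt (esym degm).
by move/mnm_lepP: lec => /(_ k); lia.
Qed.

(** Local minimality of the weight on [U] is thus global. An exchange towards [a] that stays inside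
    [U] keeps the weight and brings [b] closer to [a], so induction applies; the resulting two-step
    move is then replaced by a single one. *)
Lemma tangent_exchange (U : {pred 'I_n}) a b : B a -> B b ->
  wt (fun i => i \in U : nat) a < wt (fun i => i \in U : nat) b ->
  exists t k, [/\ t \in U, k \notin U & B (move b t k)].
Proof.
set w := fun i => _; move=> Ba.
have [N] := ubnP (mdist b a); elim: N b => // N IH b bN Bb lt.
have [t] := excess lt; rewrite /w lt0b => tU abt.
have [k abk Bm] := Bx Bb Ba abt.
case: (boolP (k \in U)) => kU; last by exists t, k.
have wm : wt w (move b t k) = wt w b.
  by have := @wt_move _ w b t k; rewrite /w tU kU; lia.
have [||t' [k' [t'U k'U Bm2]]] := IH _ _ Bm.
- by have := mdist_move abt abk; lia.
- by rewrite wm.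
have t'k' : t' != k' by apply: contraNneq k'U => <-.
have tk' : t != k' by apply: contraNneq k'U => <-.
(* The two-step move exceeds [b] at [k'], and [b] can exceed it only at [t] or [t'], both in [U]. *)
have [|s bs Bs] := dual_exchange Bb Bm2 (i := k').
  by rewrite !moveE (negbTE t'k') (negbTE tk') eqxx; lia.
exists s, k'; split=> //; move: bs; rewrite !moveE.
case: (t =P s) => [<-//|_]; case: (t' =P s) => [<-//|_].
by lia.
Qed.

(** Every exchange runs along an adjacency, so walking from [a] to [b] never changes such a
    weight. *)
Lemma wt_adj_const w a b : (forall i j, adj B i j -> w i = w j) ->
  B a -> B b -> wt w a = wt w b.
Proof.
move=> wadj + Bb; have [N] := ubnP (mdist a b); elim: N a => // N IH a aN Ba.
have [|->//|[i bai]] := @mnm_eq_or_lt _ a b; first by rewrite (Bd Ba) (Bd Bb).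
have [j abj Bm] := Bx Ba Bb bai.
rewrite -(IH _ _ Bm); last by have := mdist_move bai abj; lia.
have := @wt_move _ w a i j; rewrite (wadj i j); first by lia.
by apply: adj_move Bm => //; lia.
Qed.

(** Exchanges towards [b] at coordinates of [U] stay inside [U]. Once [a] no longer exceeds [b] on
    [U], the two agree there, because their weights on [U] are equal. *)
Lemma mix_closed (U : {pred 'I_n}) a b :
  (forall i j, adj B i j -> (i \in U) = (j \in U)) -> B a -> B b ->
  exists2 c, B c & forall i, c i = if i \in U then b i else a i.
Proof.
move=> Uadj + Bb.
have [N] := ubnP (mdist a b); elim: N a => // N IH a aN Ba.
have wab : wt (fun i => i \in U : nat) a = wt (fun i => i \in U : nat) b.
  by apply: wt_adj_const => // i j /Uadj ->.
case: (pselect (exists2 i, i \in U & b i < a i)) => [[i iU bai]|h].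
  have [j abj Bm] := Bx Ba Bb bai.
  have ij : adj B i j by apply: adj_move Bm => //; lia.
  have jU : j \in U by rewrite -(Uadj _ _ ij).
  have [|c Bc cE] := IH _ _ Bm; first by have := mdist_move bai abj; lia.
  exists c => // k; rewrite cE; case: ifPn => // kU; rewrite moveE.
  have -> : (i == k) = false by apply: contraNF kU => /eqP <-.
  have -> : (j == k) = false by apply: contraNF kU => /eqP <-.
  by lia.
exists a => // i; case: ifP => // iU.
have le k : k \in U -> a k <= b k.
  by move=> kU; rewrite leqNgt; apply/negP => lt; apply: h; exists k.
apply/eqP; rewrite eqn_leq le //= leqNgt; apply/negP => lt.
suff: wt (fun i => i \in U : nat) a < wt (fun i => i \in U : nat) b by lia.
rewrite /wt (bigD1 i) //= [ltnRHS](bigD1 i) //= iU !mul1n -addSn.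
apply: leq_add => //; apply: leq_sum => k _.
by case: (boolP (k \in U)) => [/le|_]; rewrite ?mul1n ?mul0n.
Qed.

End OneSet.

Definition msum B C m := exists a b, [/\ B a, C b & m = (a + b)%MM].

Fixpoint mpow B l : 'X_{1..n} -> Prop :=
  if l is l'.+1 then msum B (mpow B l') else fun m => m = 0%MM.

Lemma equigen_msum d e B C :
  equigenerated d B -> equigenerated e C -> equigenerated (d + e) (msum B C).
Proof. by move=> Bd Ce _ [a [b [/Bd <- /Ce <- ->]]]; rewrite mdegD. Qed.

Lemma equigen_mpow d B l : equigenerated d B -> equigenerated (l * d) (mpow B l).
Proof.
move=> Bd; elim: l => [|l IH]; first by move=> _ ->; rewrite mdeg0.
by rewrite mulSn; apply: equigen_msum.
Qed.

(* One summand always has an excess at the current position p, and moving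
   it towards the corresponding summand of b brings the decomposition of a
   closer to that of b, so this stops at some p with a p < b p. *)
Lemma exchange_msum B C : exchange B -> exchange C -> exchange (msum B C).
Proof.
move=> Bx Cx a b [a1 [a2 [Ba1 Ca2 ea]]] [b1 [b2 [Bb1 Cb2 eb]]] i bai.
have [N] := ubnP (mdist a1 b1 + mdist a2 b2).
(* The sum of the two current parts is always [a] with a unit moved from [i] to a travelling
   position [p]; at the start [p] is [i]. *)
have [p] : exists p, move a i p = (a1 + a2)%MM.
  by exists i; rewrite /move mnmU //; lia.
elim: N a1 a2 p {ea} Ba1 Ca2 => // N IH a1 a2 p Ba1 Ca2 ep lt.
case: (ltnP (a p) (b p)) => [abp|bap].
  by exists p => //; rewrite ep; exists a1, a2.
have h : b1 p < a1 p \/ b2 p < a2 p.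
  have := congr1 (fun m : 'X_{1..n} => m p) ep; rewrite moveE eqxx mnmDE.
  have := congr1 (fun m : 'X_{1..n} => m p) eb; rewrite mnmDE.
  by case: (i =P p) => [e|_]; [rewrite e in bai|]; lia.
case: h => [h|h].
  have [j hj Bm] := Bx _ _ Ba1 Bb1 _ h.
  apply: (IH (move a1 p j) a2 j Bm Ca2); last by have := mdist_move h hj; lia.
  apply/mnmP => k; have := congr1 (fun m : 'X_{1..n} => m k) ep.
  rewrite (mnmDE k a1) (mnmDE k (move a1 p j)) !moveE; case: (p =P k) => [<-|_] /=; lia.
have [j hj Cm] := Cx _ _ Ca2 Cb2 _ h.
apply: (IH a1 (move a2 p j) j Ba1 Cm); last by have := mdist_move h hj; lia.
apply/mnmP => k; have := congr1 (fun m : 'X_{1..n} => m k) ep.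
rewrite (mnmDE k a1) (mnmDE k a1 (move a2 p j)) !moveE; case: (p =P k) => [<-|_] /=; lia.
Qed.

Lemma exchange_mpow B l : exchange B -> exchange (mpow B l).
Proof.
move=> Bx; elim: l => [|l IH]; last exact: exchange_msum.
by move=> a b -> -> i; rewrite ltnn.
Qed.

Lemma mpowD B k l a b : mpow B k a -> mpow B l b -> mpow B (k + l) (a + b)%MM.
Proof.
elim: k a => [|k IH] a /=; first by move=> ->; rewrite add0m.
move=> [c [e [Bc Be ->]]] Bb; exists c, (e + b)%MM; split=> //; first exact: IH.
by rewrite addmA.
Qed.

Lemma mpow1 B a : B a -> mpow B 1 a.
Proof. by move=> Ba; exists a, 0%MM; rewrite addm0. Qed.

Lemma mpow_ex B l : (exists a, B a) -> exists a, mpow B l a.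
Proof.
case=> a Ba; elim: l => [|l [b Bb]]; first by exists 0%MM.
by exists (a + b)%MM; exists a, b.
Qed.

Lemma wt_mpow_const B l w (k : nat) : (forall a, B a -> wt w a = k) ->
  forall a, mpow B l a -> wt w a = l * k.
Proof.
move=> h; elim: l => [|l IH] a /=; first by move->; rewrite wt0.
by case=> [a1 [a2 [/h h1 /IH h2 ->]]]; rewrite wtD h1 h2.
Qed.

Lemma wt_mpow_ge B l w (k : nat) : (forall a, B a -> k <= wt w a) ->
  forall a, mpow B l a -> l * k <= wt w a.
Proof.
move=> h; elim: l => [|l IH] a //=.
by case=> [a1 [a2 [/h h1 /IH h2 ->]]]; rewrite wtD mulSn leq_add.
Qed.

Lemma mpow_map B C l (R : 'X_{1..n} -> 'X_{1..n} -> Prop) :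
  R 0%MM 0%MM ->
  (forall a b a' b', R a a' -> R b b' -> R (a + b)%MM (a' + b')%MM) ->
  (forall a, B a -> exists2 a', C a' & R a a') ->
  forall a, mpow B l a -> exists2 a', mpow C l a' & R a a'.
Proof.
move=> R0 RD BC; elim: l => [|l IH] a /=; first by move->; exists 0%MM.
case=> [a1 [a2 [/BC [c1 C1 R1] /IH [c2 C2 R2] ->]]].
by exists (c1 + c2)%MM; [exists c1, c2|apply: RD].
Qed.

Lemma connect_exit (T : finType) (e : rel T) (W : {pred T}) x y :
  connect e x y -> x \in W -> y \notin W ->
  exists u v,
    [/\ u \in W, v \notin W, e u v, connect e x u & connect e v y].
Proof.
move=> /connectP[p]; elim: p x => [|z p IH] x /=; first by move=> _ -> ->.
move=> /andP[xz pz] ly xW yW; case: (boolP (z \in W)) => zW; last first.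
  by exists x, z; split=> //; apply/connectP; exists p.
have [u [v [uW vW uv zu vy]]] := IH _ pz ly zW yW; exists u, v; split=> //.
exact: connect_trans (connect1 xz) zu.
Qed.

(* Each new vertex v, adjacent to a vertex of W through q + U_u and q + U_v,
   costs one more factor: replace the witness m of W by m + q + U_u. *)
Lemma socle_exists B (T : {set 'I_n}) l t0 :
  t0 \in T -> (exists2 a, B a & 0 < a t0) ->
  {in T &, forall i j, connect [rel x y | (y \in T) && `[< adj B x y >]] i j} ->
  0 < l -> #|T|.-1 <= l ->
  exists m, {in T, forall j, mpow B l (m + U_(j))%MM}.
Proof.
move=> t0T [a Ba at0] Tconn l0 Tl.
(* A single vertex already costs one factor, and the first edge costs no further one, since its
   common vector [q] serves both ends; hence [maxn 1 k.-1]. *)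
have key k : 0 < k <= #|T| -> exists W : {set 'I_n},
    [/\ W \subset T, #|W| = k, t0 \in W &
    exists m, {in W, forall j, mpow B (maxn 1 k.-1) (m + U_(j))%MM}].
  elim: k => // k IH kT; case: (posnP k) => [k0|k0].
    exists [set t0]; rewrite k0 cards1 sub1set t0T set11; split=> //.
    exists (a - U_(t0))%MM => j /set1P->; rewrite mnmU //.
    exact: mpow1.
  have [|W [WT cW t0W [m mW]]] := IH; first by lia.
  have /subsetPn[t tT tW] : ~~ (T \subset W).
    by apply/negP => /subset_leq_card; lia.
  have := Tconn _ _ t0T tT => /connect_exit /(_ t0W tW).
  case=> [u [v [uW vW /= /andP[vT /asboolP[q qu qv]] _ _]]].
  exists (v |: W); rewrite subUset sub1set vT WT cardsU1 vW cW inE t0W orbT.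
  split=> //; case: (ltnP 1 k) => k1.
    exists (m + q + U_(u))%MM => j.
    have -> : k = maxn 1 k.-1 + 1 by lia.
    case/setU1P=> [->|jW].
      have -> : (m + q + U_(u) + U_(v) = m + U_(u) + (q + U_(v)))%MM.
        by apply/mnmP => i; rewrite !mnmDE; lia.
      by apply: mpowD; [apply: mW|apply: mpow1].
    have -> : (m + q + U_(u) + U_(j) = m + U_(j) + (q + U_(u)))%MM.
      by apply/mnmP => i; rewrite !mnmDE; lia.
    by apply: mpowD; [apply: mW|apply: mpow1].
  have k1' : k = 1 by lia.
  rewrite k1' in cW *; have /cards1P[z Wz] : #|W| == 1 by rewrite cW.
  exists q => j; move: uW; rewrite Wz inE => /eqP <-.
  by case/setU1P => [->|/set1P->]; apply: mpow1.
have T0 : 0 < #|T| by apply/card_gt0P; exists t0.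
have [|W [WT cW _ [m mW]]] := key #|T|; first by rewrite T0 /=.
have eWT : W = T by apply/eqP; rewrite eqEcard WT cW /=.
(* The remaining factors are filled with an arbitrary element of the sumset. *)
have [|b Bb] := @mpow_ex B (l - maxn 1 #|T|.-1); first by exists a.
exists (b + m)%MM => j jT; rewrite -addmA.
have -> : l = l - maxn 1 #|T|.-1 + maxn 1 #|T|.-1 by lia.
by apply: mpowD => //; apply: mW; rewrite eWT.
Qed.

End MConvex.

(** * A flag of faces *)

Section Picks.
Variable T : finType.
Implicit Types (D : rel T) (X Y : {set T}).

Definition symrel D : rel T := [rel x y | D x y || D y x].

Definition add_edge D i j : rel T := [rel x y | D x y || (x == i) && (y == j)].

(** A path through the new edge can be cut before its first and after its last use of that edge. *)
Lemma connect_add_edge D i j x y : connect (add_edge D i j) x y ->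
  connect D x y \/ connect D x i /\ connect D j y.
Proof.
move=> /connectP[p]; elim: p x => [|z p IH] x /=.
  by move=> _ ->; left.
move=> /andP[/orP[xz|/andP[/eqP-> /eqP->]] pz] ly.
  have [zy|[zi jy]] := IH _ pz ly; first by left; apply: connect_trans (connect1 xz) zy.
  by right; split=> //; apply: connect_trans (connect1 xz) zi.
by right; split=> //; have [|[]] := IH _ pz ly.
Qed.

Lemma connect_mutual D : (forall x y, D x y -> connect D y x) ->
  forall x y, connect (symrel D) x y -> connect D x y.
Proof.
move=> h x y; apply: connect_sub => {x y} x y /= /orP[xy|/h//].
exact: connect1.
Qed.

(* Adding the reverse of an edge i -> j whose interval is minimal merges
   exactly the strong components of i and j. *)
Lemma reverse_edges k D X Y (r : T -> T) :
  {in X &, forall x y, connect D x y -> connect D y x -> x = y} ->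
  {in X, forall x, r x \in Y} ->
  {in X &, forall x y, r x = r y -> connect (symrel D) x y} ->
  #|Y| + k <= #|X| ->
  exists Ds : nat -> rel T, Ds 0 = D /\ forall q, q < k ->
    (forall x y, Ds q x y -> Ds q.+1 x y) /\
    exists i j, [/\ D i j, ~~ connect (Ds q) j i & Ds q.+1 j i].
Proof.
elim: k D X => [|k IH] D X ind rY rX le; first by exists (fun=> D).
(* If every edge had a return path, strong and undirected components would coincide, and [r] would
   embed [X] into the smaller set [Y]. *)
have [[i0 j0] /= /andP[Dij0 ji0]] :
    exists p : T * T, D p.1 p.2 && ~~ connect D p.2 p.1.
  apply: contrapT => /forallNP h.
  have sym x y : D x y -> connect D y x.
    by move=> xy; have /negP := h (x, y); rewrite /= xy negbK.
  have : ~ {in X &, injective r}.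
    move=> rinj; have := card_in_imset rinj.
    have /subset_leq_card : r @: X \subset Y by apply/subsetP => _ /imsetP[x /rY ? ->].
    lia.
  apply=> x y xX yX /(rX _ _ xX yX) xy; apply: ind => //.
    exact: (connect_mutual sym).
  apply: (connect_mutual sym); rewrite (sym_connect_sym _) // => u v.
  exact: orbC.
pose itv (p : T * T) := [set z | connect D p.1 z && connect D z p.2].
have [[i j] /= /andP[Dij ji] imin] :
  exists2 p : T * T, D p.1 p.2 && ~~ connect D p.2 p.1 &
    forall p' : T * T, D p'.1 p'.2 && ~~ connect D p'.2 p'.1 -> #|itv p| <= #|itv p'|.
  by have [p] := @arg_minnP _ (i0, j0) (fun p => D p.1 p.2 && ~~ connect D p.2 p.1)
    (fun p => #|itv p|) (introT andP (conj Dij0 ji0)); exists p.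
have cij : connect D i j by apply: connect1.
(* In a minimal interval every vertex is equivalent to [i] or to [j]: otherwise a path from [i] to
   [z] contains an irreversible edge whose interval is smaller, as it misses [j]. *)
have ends z : z \in itv (i, j) -> connect D z i \/ connect D j z.
  rewrite inE /= => /andP[iz zj].
  case: (boolP (connect D z i)) => zi; first by left.
  right; apply: contrapT => /negP jz.
  have [||u [v [ui vi uv iu vz]]] := @connect_exit _ D [pred z | connect D z i] i z iz.
  - by rewrite inE.
  - by rewrite inE.
  move: ui vi; rewrite !inE => ui vi.
  have /imin : D (u, v).1 (u, v).2 && ~~ connect D (u, v).2 (u, v).1.
    by rewrite /= uv; apply: contra vi => vu; apply: connect_trans vu ui.
  apply/negP; rewrite -ltnNge; apply: proper_card; apply/properP; split.
    apply/subsetP => c; rewrite !inE /= => /andP[uc cv].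
    by rewrite (connect_trans iu uc) (connect_trans cv) // (connect_trans vz zj).
  exists j; rewrite !inE /= ?cij ?connect0 //.
  by apply: contra jz => /andP[_ jv]; apply: connect_trans jv vz.
(* The new edge merges the components of [i] and [j], so the representative of the latter is
   dropped; at most one element is lost. *)
pose X' := X :\: [set x | connect D x j && connect D j x].
have cX : #|X| <= #|X'|.+1.
  rewrite -(cardsID [set x | connect D x j && connect D j x] X) -add1n leq_add2r.
  apply/card_le1_eqP => x y; rewrite !inE => /andP[xX /andP[xj jx]] /andP[yX /andP[yj jy]].
  by apply: ind => //; [apply: connect_trans yj jx|apply: connect_trans xj jy].
have subX x : x \in X' -> x \in X by rewrite inE => /andP[].
have [||||Ds [D0 Dq]] := IH (add_edge D j i) X'.
- move=> x y xX' yX' xy yx; have [xX yX] := (subX _ xX', subX _ yX').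
  have key z : z \in X' -> z \in itv (i, j) -> connect D z i /\ connect D i z.
    move=> zX' zI; have [|jz] := ends _ zI.
      by move: zI; rewrite inE /= => /andP[].
    move: zX' zI; rewrite !inE jz andbT /= => /andP[/negP nzj _] /andP[_ zj].
    by case: nzj.
  have both : x \in itv (i, j) -> y \in itv (i, j) -> x = y.
    move=> /(key _ xX')[xi ix] /(key _ yX')[yi iy].
    by apply: ind => //; [apply: connect_trans xi iy|apply: connect_trans yi ix].
  have [{}xy|[xj iy]] := connect_add_edge xy; have [{}yx|[yj ix]] := connect_add_edge yx.
  + exact: ind.
  + apply: both; rewrite inE /=; first by rewrite ix (connect_trans xy yj).
    by rewrite yj (connect_trans ix xy).
  + apply: both; rewrite inE /=; first by rewrite xj (connect_trans iy yx).
    by rewrite iy (connect_trans yx xj).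
  + by apply: both; rewrite inE /= ?ix ?iy.
- by move=> x /subX /rY.
- move=> x y /subX xX /subX yX rxy; apply: connect_sub (rX _ _ xX yX rxy) => u v /= uv.
  by apply: connect1; case/orP: uv => uv; rewrite /symrel /add_edge /= uv ?orbT.
- by lia.
exists (fun q => if q is q'.+1 then Ds q' else D); split=> // -[|q] qk.
  rewrite D0; split=> [x y xy|]; first by rewrite /add_edge /= xy.
  by exists i, j; rewrite /add_edge /= !eqxx orbT.
have [sub [u [v [Duv vu Dvu]]]] := Dq _ qk; split=> //.
(* The edge found must come from [D]: the added edge from [j] to [i] is excluded because its reverse
   lies in [D] and hence in every later relation. *)
move: Duv; rewrite /add_edge /= => /orP[Duv|/andP[/eqP eu /eqP ev]]; first by exists u, v.
case/negP: vu; rewrite eu ev.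
suff mono q' x y : q' <= k -> D x y -> Ds q' x y by apply: connect1; apply: mono => //; lia.
elim: q' => [|q' IHq] qk' xy; first by rewrite D0 /add_edge /= xy.
by have [+ _] := Dq _ qk'; apply; apply: IHq => //; apply: ltnW.
Qed.

End Picks.

(** * Weights exposing a flag of faces of the base polytope *)

Section FaceChain.
Variables (n d : nat) (B : 'X_{1..n} -> Prop).
Hypotheses (Bd : equigenerated d B) (Bx : exchange B).
Implicit Types (a b c : 'X_{1..n}) (D : rel 'I_n) (U : {set 'I_n}).

Definition adjr : rel 'I_n := [rel i j | `[< adj B i j >]].

Definition components : {set 'I_n} := [set i | roots adjr i].

Definition exch_rel b : rel 'I_n := [rel i j | `[< B (move b i j) >]].

Definition closedb D U := [forall x, forall y, D x y ==> (x \in U) ==> (y \in U)].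

(** The sum of the indicators of all closed sets; if each of these is minimal at a common basis, the
    minimal face of the sum is the intersection of theirs. The added one makes the weight positive
    and shifts it on [B] by the constant [d]. *)
Definition face_weight D i : nat := (\sum_(U | closedb D U) (i \in U)).+1.

Lemma adjr_sym : connect_sym adjr.
Proof.
by apply: sym_connect_sym => i j; apply/asboolP/asboolP; apply: adj_sym.
Qed.

Lemma closedbP D U : reflect (forall x y, D x y -> x \in U -> y \in U) (closedb D U).
Proof.
apply: (iffP forallP) => [h x y|h x].
  by move: (h x) => /forallP/(_ y)/implyP h' /h'/implyP.
by apply/forallP => y; apply/implyP => /h ?; apply/implyP.
Qed.

Lemma closedb_connect D x : closedb D [set y | connect D x y].
Proof.
apply/closedbP => y z yz; rewrite !inE => xy.
exact: connect_trans xy (connect1 yz).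
Qed.

Lemma sum_wt_closed b (U : {set 'I_n}) : B b ->
  (forall x y, B (move b x y) -> x \in U -> y \in U) ->
  forall a, B a -> wt (fun i => i \in U : nat) b <= wt (fun i => i \in U : nat) a.
Proof.
move=> Bb h a Ba; rewrite leqNgt; apply/negP => lt.
by have [t [k [tU /negP kU /h/(_ tU)/kU]]] := tangent_exchange Bd Bx Ba Bb lt.
Qed.

Lemma wt_face_weight D a :
  wt (face_weight D) a =
    mdeg a + \sum_(U | closedb D U) wt (fun i => i \in U : nat) a.
Proof.
rewrite /wt exchange_big -wt1 -big_split; apply: eq_bigr => i _ /=.
by rewrite /face_weight -big_distrl /=; lia.
Qed.

(** For a component [U] of the undirected exchange graph, [U] and its complement both have minimal
    weight at [b], so the weight on [U] is constant on [B]. Comparing [q + U_(i)] with [q + U_(j)]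
    puts [j] in [U]. *)
Lemma adj_exch_rel b i j : B b -> adj B i j -> connect (symrel (exch_rel b)) i j.
Proof.
move=> Bb [q qi qj].
pose U := [set z | connect (symrel (exch_rel b)) i z].
have cU x y : B (move b x y) -> (x \in U) = (y \in U).
  move=> xy; rewrite !inE; apply: same_connect_r.
    by apply: sym_connect_sym => u v; apply: orbC.
  by apply: connect1; apply/orP; left; apply/asboolP.
have wU a : B a -> wt (fun i => i \in U : nat) b = wt (fun i => i \in U : nat) a.
  move=> Ba; have h1 := sum_wt_closed Bb (U := U) (fun x y xy => etrans (esym (cU x y xy))) Ba.
  have h2 : wt (fun i => i \in ~: U : nat) b <= wt (fun i => i \in ~: U : nat) a.
    by apply: sum_wt_closed => // x y xy; rewrite !in_setC (cU x y xy).
  have tot c : wt (fun i => i \in U : nat) c + wt (fun i => i \in ~: U : nat) c = mdeg c.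
    by rewrite -wt1 -big_split; apply: eq_bigr => k _; rewrite in_setC; case: (k \in U) => /=; lia.
  move: (tot a) (tot b); rewrite (Bd Ba) (Bd Bb) => ta tb; apply/eqP.
  by rewrite eqn_leq h1 /= -(leq_add2r (wt (fun i => i \in ~: U : nat) b)) tb -ta leq_add2l.
have := esym (wU _ qi); rewrite (wU _ qj) !wtD !wtU.
by rewrite [i \in U]inE connect0 [j \in U]inE; case: connect => //; lia.
Qed.

(** The weights are the face weights of the exchange graph of [b] after [q] of its edges have been
    reversed: more edges leave fewer closed sets, hence larger faces around [b]. *)
Lemma face_chain : (exists a, B a) ->
  exists b (ws : nat -> 'I_n -> nat),
   [/\ B b, forall q i, 0 < ws q i,
      forall q, q <= n - #|components| -> forall a, B a -> wt (ws q) b <= wt (ws q) a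
    & forall q, q < n - #|components| ->
        (forall a, B a -> wt (ws q) a = wt (ws q) b -> wt (ws q.+1) a = wt (ws q.+1) b) /\
        exists a, [/\ B a, wt (ws q.+1) a = wt (ws q.+1) b & wt (ws q) a <> wt (ws q) b]].
Proof.
move=> [a0 Ba0].
have [b [Bb bmin]] : exists b, B b /\ forall a, B a ->
    wt (fun i : 'I_n => i) b <= wt (fun i : 'I_n => i) a.
  have [N] := ubnP (wt (fun i : 'I_n => i) a0).
  elim: N a0 Ba0 => // N IH a Ba lt.
  case: (pselect (exists2 c, B c & wt (fun i : 'I_n => i) c < wt (fun i : 'I_n => i) a)).
    by case=> c Bc lc; apply: (IH c) => //; lia.
  move=> h; exists a; split=> // c Bc; rewrite leqNgt; apply/negP => lc.
  by apply: h; exists c.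
pose D := exch_rel b.
(* The coordinates have distinct weights, so an exchange out of the minimal [b] can only raise the
   index, and no two distinct vertices lie on a common directed cycle. *)
have Dle x y : connect D x y -> x <= y.
  move=> /connectP[p]; elim: p x => [|z p IH] x /=; first by move=> _ ->.
  move=> /andP[/asboolP Bm pz] ly; apply: leq_trans (IH _ pz ly).
  have bx := equigen_move Bd Bb Bm.
  by have := bmin _ Bm; have := @wt_move _ (fun i : 'I_n => i) b x z bx; lia.
have [||||Ds [D0 Dq]] := @reverse_edges _ (n - #|components|) D setT
  components (fingraph.root adjr).
- by move=> x y _ _ /Dle xy /Dle yx; apply/val_inj/eqP; rewrite eqn_leq xy yx.
- by move=> x _; rewrite inE; apply: roots_root; apply: adjr_sym.
- move=> x y _ _ /eqP; rewrite root_connect; last exact: adjr_sym.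
  by apply: connect_sub => u v /asboolP; apply: adj_exch_rel.
- by rewrite cardsT card_ord subnKC // -[leqRHS]card_ord max_card.
have DDs q x y : q <= n - #|components| -> D x y -> Ds q x y.
  elim: q => [|q IHq] qk xy; first by rewrite D0.
  by have [+ _] := Dq _ qk; apply; apply: IHq => //; apply: ltnW.
have Uge q U a : q <= n - #|components| -> closedb (Ds q) U -> B a ->
    wt (fun i => i \in U : nat) b <= wt (fun i => i \in U : nat) a.
  move=> qk /closedbP cU; apply: sum_wt_closed => // x y xy; apply: cU.
  by apply: DDs => //; apply/asboolP.
exists b, (fun q => face_weight (Ds q)); split=> // [q qk a Ba|q qk].
  rewrite !wt_face_weight (Bd Ba) (Bd Bb) leq_add2l; apply: leq_sum => U cU.
  exact: (Uge q).
have [sub [i [j [/asboolP Bij ji Dji]]]] := Dq _ qk.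
have subU U : closedb (Ds q.+1) U -> closedb (Ds q) U.
  by move=> /closedbP h; apply/closedbP => x y /sub; apply: h.
split.
  move=> a Ba; rewrite !wt_face_weight (Bd Ba) (Bd Bb) => /addnI e.
  (* Each closed set has weight at least its value at [b], so equality of the sums forces equality
     term by term. *)
  have eU U : closedb (Ds q) U ->
      wt (fun i => i \in U : nat) a = wt (fun i => i \in U : nat) b.
    move=> cU; apply/eqP; rewrite eqn_leq (Uge q) ?andbT //; last exact: ltnW.
    move: e; rewrite (bigD1 U) //= [RHS](bigD1 U) //= => e.
    rewrite -(leq_add2r (\sum_(V | closedb (Ds q) V && (V != U))
      wt (fun i => i \in V : nat) b)) -e leq_add2l.
    by apply: leq_sum => V /andP[cV _]; apply: (Uge q) => //; apply: ltnW.
  by congr (_ + _); apply: eq_bigr => U /subU /eU.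
(* This exchange lies on the next face, where [i] and [j] belong to the same closed sets, but not on
   the current one, where the set reachable from [j] misses [i]. *)
exists (move b i j); have bi := equigen_move Bd Bb Bij.
have Dij q' : q' <= n - #|components| -> Ds q' i j.
  by move=> qk'; apply: DDs => //; apply/asboolP.
split=> //.
  have := @wt_move _ (face_weight (Ds q.+1)) b i j bi.
  suff -> : face_weight (Ds q.+1) i = face_weight (Ds q.+1) j by lia.
  congr _.+1; apply: eq_bigr => U /closedbP cU; congr (nat_of_bool _).
  by apply/idP/idP; apply: cU => //; apply: Dij.
have := @wt_move _ (face_weight (Ds q)) b i j bi.
suff: face_weight (Ds q) i < face_weight (Ds q) j by lia.
rewrite /face_weight ltnS (bigD1 [set z | connect (Ds q) j z]) ?closedb_connect //=.
rewrite [ltnRHS](bigD1 [set z | connect (Ds q) j z]) ?closedb_connect //=.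
rewrite !inE connect0 (negbTE ji) add0n add1n ltnS.
apply: leq_sum => U /andP[/closedbP cU _]; case: (boolP (i \in U)) => // iU.
by rewrite (cU i j) // Dij // ltnW.
Qed.

End FaceChain.

(** * Monomial ideals and their associated primes *)

Section Ideals.
Local Open Scope ring_scope.
Variable R : comNzRingType.
Implicit Types (G J : {pred R}) (u v : R).

(** Unlike [idealr_closed], this admits the unit ideal. *)
Definition is_ideal J : Prop :=
  [/\ 0 \in J, {in J &, forall u v, u + v \in J} & forall a, {in J, forall u, a * u \in J}].

Lemma is_ideal_gen G : is_ideal (ideal_gen G).
Proof.
by split; [apply: ideal_gen0|apply: ideal_genD|move=> a u; apply: ideal_genMl].
Qed.

Section Theory.
Variables (J : {pred R}) (iJ : is_ideal J).

Lemma is_ideal0 : 0 \in J. Proof. by case: iJ. Qed.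

Lemma is_idealD u v : u \in J -> v \in J -> u + v \in J.
Proof. by case: iJ => _ h _; apply: h. Qed.

Lemma is_idealMl a u : u \in J -> a * u \in J.
Proof. by case: iJ => _ _ h; apply: h. Qed.

Lemma is_idealMr a u : u \in J -> u * a \in J.
Proof. by rewrite mulrC; apply: is_idealMl. Qed.

Lemma is_idealN u : u \in J -> - u \in J.
Proof. by rewrite -mulN1r; apply: is_idealMl. Qed.

Lemma is_idealB u v : u \in J -> v \in J -> u - v \in J.
Proof. by move=> uJ /is_idealN; apply: is_idealD. Qed.

Lemma is_idealDr u v : u \in J -> (u + v \in J) = (v \in J).
Proof.
move=> uJ; apply/idP/idP => [h|]; last exact: is_idealD.
by rewrite -[v](addKr u) addrC; apply: is_idealB.
Qed.

Lemma is_ideal_sum (T : Type) (s : seq T) (Q : pred T) (F : T -> R) :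
  (forall t, Q t -> F t \in J) -> \sum_(t <- s | Q t) F t \in J.
Proof.
by move=> FJ; elim/big_ind: _ => //; [apply: is_ideal0|apply: is_idealD].
Qed.

Lemma ideal_gen_le G : {subset G <= J} -> {subset ideal_gen G <= J}.
Proof.
move=> GJ _ /asboolP[s sG ->]; rewrite big_seq; apply: is_ideal_sum => cg /sG /GJ.
exact: is_idealMl.
Qed.

Lemma is_ideal_closed : 1 \notin J -> idealr_closed J.
Proof.
move=> J1; split=> //; first exact: is_ideal0.
by move=> a u v uJ vJ; apply: is_idealD => //; apply: is_idealMl.
Qed.

End Theory.

Lemma idealr_closed_is_ideal J : idealr_closed J -> is_ideal J.
Proof.
case=> J0 _ JD; split=> // [u v uJ vJ|a u uJ].
  by rewrite -[u]mul1r; apply: JD.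
by rewrite -[_ * _]addr0; apply: JD.
Qed.

End Ideals.

Section MonomialIdeals.
Local Open Scope ring_scope.
Variables (K : fieldType) (n : nat).
Local Notation S := {mpoly K[n]}.
Implicit Types (C D : 'X_{1..n} -> Prop) (m a u w : 'X_{1..n}) (f g h : S).

Definition up C m : Prop := exists2 a, C a & (a <= m)%MM.

(** Describing the monomial ideal by supports lets membership be tested term by term. *)
Definition mideal C : {pred S} := fun h => `[< forall m, m \in msupp h -> up C m >].

Lemma up_add C m u : up C m -> up C (m + u)%MM.
Proof. by case=> a Ca am; exists a => //; apply: lepm_trans am (lem_addr _ _). Qed.

Lemma up_self C a : C a -> up C a.
Proof. by exists a; rewrite ?lepm_refl. Qed.

Lemma midealP C h : reflect (forall m, h@_m != 0 -> up C m) (h \in mideal C).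
Proof.
apply: (iffP idP) => [/asboolP hC m|hC]; first by rewrite -mcoeff_msupp; apply: hC.
by apply/asboolP => m; rewrite mcoeff_msupp; apply: hC.
Qed.

Lemma is_ideal_mideal C : is_ideal (mideal C).
Proof.
split=> [|f g /asboolP fC /asboolP gC|f g /asboolP gC]; apply/asboolP => m.
- by rewrite -mpolyC0 msupp0.
- by move/msuppD_le; rewrite mem_cat => /orP[/fC|/gC].
by move/msuppM_le => /allpairsP[[m1 m2] [_ /gC h ->]]; rewrite addmC; apply: up_add.
Qed.

Lemma midealX C m : 'X_[m] \in mideal C <-> up C m.
Proof.
split=> [/asboolP/(_ m)|h]; first by rewrite msuppX inE eqxx => /(_ isT).
by apply/asboolP => u; rewrite msuppX inE => /eqP->.
Qed.

Lemma midealM C D f g : f \in mideal C -> g \in mideal D -> f * g \in mideal (msum C D).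
Proof.
move=> /asboolP fC /asboolP gD; apply/asboolP => m /msuppM_le.
case/allpairsP => [[m1 m2]] /= [/fC[a Ca /mnm_lepP la] /gD[b Db /mnm_lepP lb] ->].
exists (a + b)%MM; first by exists a, b.
by apply/mnm_lepP => i; rewrite !mnmDE leq_add.
Qed.

Lemma mpolyX_dvd a m : (a <= m)%MM -> 'X_[m] = 'X_[m - a] * 'X_[a] :> S.
Proof. by move=> am; rewrite -mpolyXD submK. Qed.

Lemma mideal_le C (J : {pred S}) : is_ideal J ->
  (forall a, C a -> 'X_[a] \in J) -> {subset mideal C <= J}.
Proof.
move=> iJ CJ h /asboolP hC; rewrite [h]mpolyE big_seq; apply: is_ideal_sum => // m /hC[a Ca am].
by rewrite (mpolyX_dvd am) -mul_mpolyC !mulrA; apply: is_idealMl => //; apply: CJ.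
Qed.

Lemma ideal_gen_monomials (B : {pred 'X_{1..n}}) :
  ideal_gen (monomials (K := K) B) =i mideal (fun a => a \in B).
Proof.
move=> h; apply/idP/idP.
  apply: ideal_gen_le; first exact: is_ideal_mideal.
  by move=> _ /asboolP[a aB ->]; apply/midealX/up_self.
apply: mideal_le; first exact: is_ideal_gen.
by move=> a aB; apply: ideal_gen_sub; apply/asboolP; exists a.
Qed.

Lemma ideal_pow_mideal I C l : I =i mideal C -> ideal_pow I l =i mideal (mpow C l).
Proof.
move=> IC h; apply/idP/idP.
  apply: ideal_gen_le; first exact: is_ideal_mideal.
  move=> _ /asboolP[s [<- sI ->]]; elim: s sI => [|g s IH] sI.
    by rewrite big_nil -mpolyX0; apply/midealX/up_self.
  rewrite big_cons; apply: midealM; first by rewrite -IC sI ?mem_head.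
  by apply: IH => x xs; rewrite sI // inE xs orbT.
apply: mideal_le; first exact: is_ideal_gen.
move=> a aC; apply: ideal_gen_sub; apply/asboolP.
elim: l a aC => [|l IH] a /=; first by move=> ->; exists [::]; rewrite big_nil mpolyX0.
case=> [b [c [Cb /IH[s [ss sI sE]] ->]]]; exists ('X_[b] :: s); split.
- by rewrite /= ss.
- by move=> x; rewrite inE => /orP[/eqP->|/sI//]; rewrite IC; apply/midealX/up_self.
by rewrite big_cons -sE mpolyXD.
Qed.

Definition mpart (Q : pred 'X_{1..n}) f : S := \sum_(m <- msupp f | Q m) f@_m *: 'X_[m].

Lemma mcoeff_mpart Q f m : (mpart Q f)@_m = if Q m then f@_m else 0.
Proof.
rewrite /mpart raddf_sum /=.
have e u : (f@_u *: 'X_[u])@_m = if u == m then f@_m else 0.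
  by rewrite mcoeffZ mcoeffX; case: eqP => [->|_]; rewrite ?mulr1 ?mulr0.
rewrite (eq_bigr _ (fun u _ => e u)) -big_mkcondr /=.
case: ifP => Qm; last by rewrite big1 // => u /andP[Qu /eqP um]; rewrite um Qm in Qu.
case: (boolP (m \in msupp f)) => mf.
  rewrite -big_filter.
  rewrite (_ : filter _ _ = [:: m]) ?big_seq1 //.
  transitivity (filter (pred1 m) (msupp f)).
    by apply: eq_filter => u /=; case: eqP => [->|]; rewrite ?andbT ?andbF.
  by rewrite filter_pred1_uniq // msupp_uniq.
rewrite big_seq_cond big1 => [|u /and3P[uf _ /eqP um]]; last by rewrite -um uf in mf.
by apply/esym/eqP; rewrite mcoeff_eq0.
Qed.

Definition outside C : pred 'X_{1..n} := fun m => ~~ `[< up C m >].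

Lemma mideal_outside C f : f - mpart (outside C) f \in mideal C.
Proof.
apply/midealP => m; rewrite mcoeffB mcoeff_mpart /outside.
by case: asboolP => //= _; rewrite subrr eqxx.
Qed.

(** Once the terms in the ideal are discarded, the leading monomials of [f] and [g] lie outside it,
    while their product is the leading monomial of a member. *)
Lemma mideal_prime C : (forall m m', up C (m + m')%MM -> up C m \/ up C m') ->
  prime_idealr_closed (mideal C).
Proof.
move=> prC f g fg; apply/orP; apply: contrapT => /not_orP[fC gC].
have iC := is_ideal_mideal C.
pose f' := mpart (outside C) f; pose g' := mpart (outside C) g.
have nz k : ~ k \in mideal C -> mpart (outside C) k != 0.
  by apply: contra_not_neq => k0; have := mideal_outside C k; rewrite k0 subr0.
have out k : mpart (outside C) k != 0 -> ~ up C (mlead (mpart (outside C) k)).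
  by move/mlead_supp; rewrite mcoeff_msupp mcoeff_mpart; case: ifP; rewrite ?eqxx // => /asboolPn.
have : f' * g' \in mideal C.
  have -> : f' * g' = f * g - ((f - f') * g + f' * (g - g')) by ring.
  apply: is_idealB => //; apply: is_idealD => //.
    by apply: is_idealMr => //; apply: mideal_outside.
  by apply: is_idealMl => //; apply: mideal_outside.
move/midealP => /(_ (mlead f' + mlead g')%MM).
rewrite mleadcM mulf_neq0 ?mleadc_eq0 ?nz // => /(_ isT) /prC [].
  exact: out (nz _ fC).
exact: out (nz _ gC).
Qed.

Definition var_prime (A : {set 'I_n}) : {pred S} :=
  mideal (fun a => exists2 i, i \in A & a = U_(i)%MM).

Lemma up_var (A : {set 'I_n}) m :
  up (fun a => exists2 i, i \in A & a = U_(i)%MM) m <-> exists2 i, i \in A & (0 < m i)%N.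
Proof.
split=> [[_ [i iA ->] /mnm_lepP/(_ i)]|[i iA mi]].
  by rewrite mnm1E eqxx; exists i.
exists U_(i)%MM; first by exists i.
by apply/mnm_lepP => j; rewrite mnm1E; case: eqP => // <-.
Qed.

Lemma var_prime_prime A : prime_ideal (var_prime A).
Proof.
split; last first.
  apply: mideal_prime => m m' /up_var[i iA]; rewrite mnmDE => h.
  case: (posnP (m i)) => mi; [right|left]; apply/up_var; exists i => //.
  by rewrite mi in h.
apply: is_ideal_closed; first exact: is_ideal_mideal.
apply/negP; rewrite -mpolyX0 => /midealX/up_var[i _].
by rewrite mnm0E.
Qed.

Lemma prime_mono (P : {pred S}) m : prime_ideal P -> 'X_[m] \in P ->
  exists2 i, 'X_i \in P & (0 < m i)%N.
Proof.
move=> [[_ P1 _] prP]; have [N] := ubnP (mdeg m); elim: N m => // N IH m mN mP.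
have [i mi] : exists i, (0 < m i)%N.
  apply: contrapT => /forallNP h; case/negP: P1; rewrite -mpolyX0.
  suff -> : 0%MM = m by [].
  by apply/mnmP => i; rewrite mnm0E; move: (h i); case: (m i).
move: mP; rewrite -{1}(mnmU mi) mpolyXD => /prP /orP[mP|]; last by exists i.
have degm : (mdeg (m - U_(i))%MM < mdeg m)%N.
  by rewrite -{2}(mnmU mi) mdegD mdeg1 addn1.
have [|j Pj mj] := IH _ _ mP; first exact: leq_trans degm _.
by exists j => //; move: mj; rewrite mnmBE; lia.
Qed.

(** These conditions say that the annihilator of ['X_[w]] modulo the monomial ideal of [C] is
    [var_prime A]. *)
Definition ass_witness C (A : {set 'I_n}) w :=
  {in A, forall i, up C (w + U_(i))%MM} /\
  forall u, {in A, forall i, u i = 0%N} -> ~ up C (w + u)%MM.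

Lemma var_prime_associated C A w : ass_witness C A w ->
  associated_prime (mideal C) (var_prime A).
Proof.
move=> [wA wout]; split; first exact: var_prime_prime.
exists 'X_[w] => g; apply/idP/idP => /asboolP gP; apply/asboolP => m.
  rewrite (perm_mem (msuppMX _ _)) => /mapP[u /gP/up_var[i iA ui] ->].
  by rewrite -(mnmU ui) [(u - _ + _)%MM]addmC addmA; apply/up_add/wA.
move=> mg; apply/up_var; apply: contrapT => h.
apply: (wout m) => [i iA|]; first by case: (posnP (m i)) => // mi; case: h; exists i.
by apply: gP; rewrite (perm_mem (msuppMX _ _)); apply: map_f.
Qed.

(* Multiplying f by a monomial outside P, or dropping terms of f that lie in J,
   does not change Ann(f + J) = P; when a monomial of some g in P is not in P,
   the product of leading terms lies in J, and f can be replaced by an element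
   with fewer terms. *)
Lemma associated_mideal C (P : {pred S}) : associated_prime (mideal C) P ->
  exists A, P =i var_prime A /\ exists w, ass_witness C A w.
Proof.
set J := mideal C; have iJ : is_ideal J by apply: is_ideal_mideal.
case=> primeP; have [iP prP] := primeP; have {}iP := idealr_closed_is_ideal iP.
case=> f; have [N] := ubnP (size (msupp f)); elim: N f => // N IH f fN fP.
have drop f1 m : (forall g, (g \in P) = (g * f1 \in J)) -> (size (msupp f1) <= N)%N ->
    m \in msupp f1 -> up C m ->
    exists A, P =i var_prime A /\ exists w, ass_witness C A w.
  move=> f1P f1N mf1 Cm; apply: (IH (f1 - f1@_m *: 'X_[m])).
    rewrite (perm_size (msupp_rem _ _)) size_rem //.
    by case: (size _) f1N (size_eq0 (msupp f1)) mf1 => //= _; case: (msupp f1).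
  move=> g; rewrite f1P mulrBr addrC is_idealDr //.
  by apply: is_idealN => //; rewrite -mul_mpolyC; do 2 apply: is_idealMl => //; apply/midealX.
case: (pselect (exists2 m, m \in msupp f & up C m)) => [[m]|nof]; first exact: drop.
case: (pselect (exists2 g, g \in P & exists2 m, m \in msupp g & 'X_[m] \notin P)).
  case=> g gP [m0 m0g m0P].
  pose g' := mpart (fun m => 'X_[m] \notin P) g.
  have g'P : g' \in P.
    rewrite -[g'](subKr g); apply: is_idealB => //.
    rewrite [g - g']mpolyE big_seq; apply: is_ideal_sum => // m.
    rewrite mcoeff_msupp mcoeffB mcoeff_mpart; case: (boolP (_ \in P)) => [mP _|_].
      by rewrite -mul_mpolyC; apply: is_idealMl.
    by rewrite subrr eqxx.
  have g'0 : g' != 0.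
    apply/eqP => /(congr1 (mcoeff m0)); rewrite mcoeff_mpart m0P mcoeff0.
    by apply/eqP; rewrite -mcoeff_msupp.
  have f0 : f != 0.
    apply/eqP => f0; case: iP => _ _ _; have := fP 1; rewrite f0 mulr0 is_ideal0 //.
    by case: primeP => [[_ /negP P1 _] _] /P1.
  have lP : 'X_[mlead g'] \notin P.
    by have := mlead_supp g'0; rewrite mcoeff_msupp mcoeff_mpart; case: ifP; rewrite ?eqxx.
  apply: (drop (f * 'X_[mlead g']) (mlead g' + mlead f)%MM).
  - move=> k; rewrite mulrCA [f * _]mulrC -fP; apply/idP/idP.
      exact: is_idealMr.
    by move/prP; rewrite (negbTE lP) orbF.
  - by rewrite (perm_size (msuppMX _ _)) size_map.
  - by rewrite (perm_mem (msuppMX _ _)) map_f // mlead_supp.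
  have /midealP/(_ (mlead g' + mlead f)%MM) : g' * f \in J by rewrite -fP.
  by rewrite mleadcM mulf_neq0 ?mleadc_eq0 // => /(_ isT).
move=> Pmono; pose A := [set i | 'X_i \in P].
have PA : P =i var_prime A.
  move=> h; apply/idP/idP => [hP|].
    apply/asboolP => m mh; have : 'X_[m] \in P.
      by apply: contrapT => /negP mP; apply: Pmono; exists h => //; exists m.
    by case/(prime_mono primeP) => i Pi mi; apply/up_var; exists i; rewrite ?inE.
  by apply: mideal_le => // _ [i iA ->]; move: iA; rewrite inE.
exists A; split=> //; apply: contrapT => /forallNP now.
(* If no term of [f] were a witness, each would be carried into [J] by a monomial free of the
   variables of [A]. The product of these monomials kills [f], so it lies in [P] and involves a
   variable of [A], a contradiction. *)
have /choice[F FP] : forall w, exists u, w \in msupp f ->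
    {in A, forall i, u i = 0%N} /\ up C (w + u)%MM.
  move=> w; case: (boolP (w \in msupp f)) => wf; last by exists 0%MM.
  apply: contrapT => /forallNP h; apply: (now w); split=> [i|u uA Cu].
    rewrite inE fP => /asboolP; apply.
    by rewrite mulrC (perm_mem (msuppMX _ _)) addmC map_f.
  by apply: (h u) => _.
pose M := (\sum_(w <- msupp f) F w)%MM.
have MP : 'X_[M] \in P.
  rewrite fP; apply/asboolP => m; rewrite mulrC (perm_mem (msuppMX _ _)).
  case/mapP => w wf ->; have [_ Cw] := FP _ wf.
  have -> : M = (F w + \sum_(u <- rem w (msupp f)) F u)%MM.
    by rewrite /M (big_rem w wf).
  by rewrite addmC addmA; apply: up_add.
have [i Pi] := prime_mono primeP MP; rewrite mnm_sumE big_seq big1 // => w wf.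
by have [-> //] := FP _ wf; rewrite inE.
Qed.

End MonomialIdeals.

(** * Stability of the associated primes *)

Section AssStability.
Variables (n d : nat) (B : 'X_{1..n} -> Prop).
Hypotheses (Bd : equigenerated d B) (Bx : exchange B) (B0 : exists a, B a).
Implicit Types (a b c m w u q : 'X_{1..n}) (A : {set 'I_n}).

Lemma mpow_pos C l m (t : 'I_n) : mpow C l m -> 0 < m t -> exists2 a, C a & 0 < a t.
Proof.
elim: l m => [|l IH] m /=; first by move=> ->; rewrite mnm0E.
case=> [a [b [Ca Cb ->]]]; rewrite mnmDE; case: (posnP (a t)) => [->|at0 _].
  exact: IH Cb.
by exists a.
Qed.

(** All of [A] lies in one component, so it contains at most one of the chosen roots. *)
Lemma card_connected A : {in A &, forall i j, connect (adjr B) i j} ->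
  #|A|.-1 <= n - #|components B|.
Proof.
move=> Aconn; have : #|A :|: components B| <= n by rewrite -[leqRHS]card_ord max_card.
have : #|A :&: components B| <= 1.
  apply/card_le1_eqP => x y; rewrite !inE => /andP[xA xr] /andP[yA yr].
  have := Aconn _ _ yA xA; rewrite -root_connect; last exact: adjr_sym.
  by move: xr yr; rewrite /roots => /eqP -> /eqP -> /eqP.
rewrite cardsU; have := subset_leq_card (subsetIl A (components B)).
have := subset_leq_card (subsetIr A (components B)); lia.
Qed.

(** * Localization at the variables of a set *)

Section Localization.
Variables (A : {set 'I_n}) (mu : nat).
Let wA : 'I_n -> nat := fun i => i \in A.
Hypotheses (mu_le : forall a, B a -> mu <= wt wA a).
Hypotheses (mu_ex : exists2 a, B a & wt wA a = mu).

Definition restrict a : 'X_{1..n} := [multinom if i \in A then a i else 0 | i < n].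

(** Generators left after setting the variables outside [A] to one; by [minimal_below], those of
    minimal weight suffice. *)
Definition loc m := exists a, [/\ B a, wt wA a = mu & m = restrict a].

Lemma restrictE a i : restrict a i = if i \in A then a i else 0.
Proof. by rewrite mnmE. Qed.

Lemma mdeg_restrict a : mdeg (restrict a) = wt wA a.
Proof.
rewrite mdegE; apply: eq_bigr => i _; rewrite restrictE /wA.
by case: (i \in A); rewrite ?mul1n.
Qed.

Lemma restrictD a b : restrict (a + b)%MM = (restrict a + restrict b)%MM.
Proof. by apply/mnmP => i; rewrite mnmDE !restrictE mnmDE; case: ifP. Qed.

(** While the weight is not minimal, [tangent_exchange] moves a unit out of [A], which only lowers
    coordinates in [A]. *)
Lemma minimal_below b : B b -> exists c, [/\ B c, wt wA c = mu & {in A, forall i, c i <= b i}].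
Proof.
have [N] := ubnP (wt wA b); elim: N b => // N IH b bN Bb.
case: (ltngtP mu (wt wA b)) => [lt|gt|e]; last by exists b; split.
  have [a Ba amu] := mu_ex; rewrite -amu in lt.
  have [t [k [tA kA Bm]]] := tangent_exchange Bd Bx Ba Bb lt.
  have bt := equigen_move Bd Bb Bm.
  have wm := @wt_move _ wA b t k bt.
  have wt1 : wA t = 1 by rewrite /wA tA.
  have wk0 : wA k = 0 by rewrite /wA (negbTE kA).
  have [|c [Bc cmu cle]] := IH _ _ Bm; first by lia.
  exists c; split=> // i iA; apply: leq_trans (cle _ iA) _; rewrite moveE.
  have -> : (k == i) = false by apply: contraNF kA => /eqP ->.
  by lia.
by have := mu_le Bb; lia.
Qed.

Lemma equigen_loc : equigenerated mu loc.
Proof. by move=> _ [a [_ <- ->]]; apply: mdeg_restrict. Qed.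

(* Moving a unit out of A would bring the weight on A below its minimum. *)
Lemma move_stays a i k : B a -> wt wA a = mu -> i \in A -> B (move a i k) -> k \in A.
Proof.
move=> Ba amu iA Bm; apply: contraT => kA.
have := @wt_move _ wA a i k (equigen_move Bd Ba Bm).
have -> : wA i = 1 by rewrite /wA iA.
have -> : wA k = 0 by rewrite /wA (negbTE kA).
by have := mu_le Bm; lia.
Qed.

Lemma exchange_loc : exchange loc.
Proof.
move=> _ _ [a [Ba amu ->]] [b [Bb bmu ->]] i; rewrite !restrictE.
case: ifP => // iA lt; have [j abj Bm] := Bx Ba Bb lt.
have jA := move_stays Ba amu iA Bm.
exists j; rewrite ?restrictE ?jA //; exists (move a i j); split=> //.
  have := @wt_move _ wA a i j (equigen_move Bd Ba Bm).
  have -> : wA i = 1 by rewrite /wA iA.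
  have -> : wA j = 1 by rewrite /wA jA.
  by lia.
apply/mnmP => k; rewrite restrictE !moveE restrictE.
case: ifP => // /negbT kA; have -> : (j == k) = false by apply: contraNF kA => /eqP <-.
by lia.
Qed.

Lemma adj_locA i j : adj loc i j -> i \in A.
Proof.
case=> q [a [_ _ e]] _; have := congr1 (fun m : 'X_{1..n} => m i) e.
by rewrite mnmDE mnm1E eqxx restrictE; case: ifP => //; lia.
Qed.

(** On [A] the two bases differ only at [i] and [j], and an exchange at [i] from a basis of minimal
    weight stays in [A], so it can only lead to [j]. *)
Lemma adj_loc i j : adj loc i j -> i = j \/ adj B i j.
Proof.
move=> ij; case: (i =P j) => [|ne]; [by left|right].
have iA := adj_locA ij; case: ij => q [a [Ba amu ea]] [b [Bb bmu eb]].
have lt : b i < a i.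
  have := congr1 (fun m : 'X_{1..n} => m i) ea; have := congr1 (fun m : 'X_{1..n} => m i) eb.
  by rewrite !restrictE !mnmDE !mnm1E iA eqxx; case: eqP => [/esym/ne//|_]; lia.
have [k abk Bm] := Bx Ba Bb lt; have kA := move_stays Ba amu iA Bm.
suff -> : j = k by apply: adj_move Bm => //; lia.
have := congr1 (fun m : 'X_{1..n} => m k) ea; have := congr1 (fun m : 'X_{1..n} => m k) eb.
by rewrite !restrictE !mnmDE !mnm1E kA; case: (j =P k) => // _; lia.
Qed.

Lemma mpow_loc_lift l m : mpow loc l m -> exists2 a, mpow B l a & m = restrict a.
Proof.
move: m; apply: (mpow_map (R := fun m a => m = restrict a)) =>
  [|a b a' b' -> ->|_ [a [Ba _ ->]]]; last by exists a.
  by apply/mnmP => i; rewrite restrictE mnm0E; case: ifP.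
by rewrite restrictD.
Qed.

Lemma mpow_loc_below l b : mpow B l b -> exists2 m, mpow loc l m & forall i, m i <= b i.
Proof.
move: b; apply: (mpow_map (R := fun b m => forall i, m i <= b i)) =>
  [|a c a' c' ha hc i|a Ba]; first by [].
  by rewrite !mnmDE leq_add.
have [c [Bc cmu cle]] := minimal_below Ba.
exists (restrict c); first by exists c.
by move=> i; rewrite restrictE; case: ifP => // iA; apply: cle.
Qed.

(** For each [i] in [A], some [m i] in the sumset of [loc] exceeds [w] on [A] only at [i], by one.
    Exchanges between these vectors connect the elements of [A]. *)
Lemma ass_witness_loc l w : ass_witness (mpow B l) A w ->
  exists2 t0, t0 \in A & (exists2 a, loc a & 0 < a t0) /\
  {in A &, forall i j, connect [rel x y | (y \in A) && `[< adj loc x y >]] i j}.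
Proof.
move=> [wA1 wA2].
have nle m : mpow loc l m -> ~ {in A, forall i, m i <= w i}.
  move=> /mpow_loc_lift[a Ba ->] le.
  apply: (wA2 [multinom if i \in A then 0 else a i | i < n]).
    by move=> i iA; rewrite mnmE iA.
  exists a => //; apply/mnm_lepP => i; rewrite mnmDE mnmE.
  by case: ifP => [iA|_]; [have := le _ iA; rewrite restrictE iA|]; lia.
have /choice[m mP] i : exists m, i \in A ->
    [/\ mpow loc l m, m i = (w i).+1 & forall k, m k <= w k + (i == k)].
  case: (boolP (i \in A)) => iA; last by exists 0%MM.
  have [b Bb /mnm_lepP blw] := wA1 _ iA.
  have [m Lm mb] := mpow_loc_below Bb; exists m => _.
  have le k : m k <= w k + (i == k).
    by apply: leq_trans (mb k) _; have := blw k; rewrite mnmDE mnm1E.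
  split=> //; apply/eqP; rewrite eqn_leq; apply/andP; split.
    by have := le i; rewrite eqxx addn1.
  rewrite ltnNge; apply/negP => mi; apply: (nle _ Lm) => k kA.
  by have := le k; case: eqP => [<-//|_]; rewrite addn0.
have [t0 t0A] : exists t0, t0 \in A.
  apply: contrapT => /forallNP h; have [a Ba] := mpow_ex l B0.
  apply: (wA2 a) => [i iA|]; first by case: (h i).
  by exists a => //; apply: lem_addl.
exists t0 => //; split.
  by have [Lm mt _] := mP _ t0A; apply: mpow_pos Lm _; rewrite mt.
move=> i j iA jA; case: (i =P j) => [->//|ij].
set e : rel 'I_n := [rel x y | _].
have [Li mi lei] := mP _ iA; have [Lj mj lej] := mP _ jA.
have lt : m j i < m i i by have := lej i; rewrite mi; case: eqP => [/esym/ij//|_]; lia.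
have [k mk Lk] := exchange_mpow exchange_loc Li Lj lt.
(* Any other target would leave the result below [w] on [A], which [nle] forbids. *)
have kj : k = j.
  apply: contrapT => kj; apply: (nle _ Lk) => t tA; rewrite moveE.
  case: (k =P t) => [<-|_]; last by have := lei t; case: (i =P t) => [<-|_]; lia.
  have -> : (i == k) = false by apply/eqP => ik; move: mk lt; rewrite ik; lia.
  by have := lej k; have -> : (j == k) = false by [apply/eqP => /esym]; lia.
rewrite kj in Lk.
(* The indicator of what [i] reaches is constant along adjacencies, hence on the sumset; comparing
   [m i] with its move gives equal values at [i] and [j]. *)
pose om x : nat := connect e i x.
have om_adj x y : adj loc x y -> om x = om y.
  move=> xy; congr (nat_of_bool _); apply/idP/idP => h; apply: connect_trans h (connect1 _).
    by rewrite /e /= (adj_locA (adj_sym xy)); apply/asboolP.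
  by rewrite /e /= (adj_locA xy); apply/asboolP/adj_sym.
have [a La] : exists a, loc a by have [a Ba ?] := mu_ex; exists (restrict a), a.
have := wt_mpow_const (fun b Lb => wt_adj_const equigen_loc exchange_loc om_adj Lb La).
have mi0 : 0 < m i i by rewrite mi.
move=> omc; have := wt_move om j mi0; rewrite (omc _ _ Li) (omc _ _ Lk).
move/addnI; rewrite /om connect0; by case: connect.
Qed.

Lemma loc_ass_witness l t0 m : t0 \in A ->
  {in A, forall j, mpow loc l (m + U_(j))%MM} -> exists w, ass_witness (mpow B l) A w.
Proof.
(* Off [A] the exponent [l * d], the degree of the sumset, bounds every coordinate and imposes no
   condition. On [A] the degree of [m] is one below the minimal weight [l * mu], so no element of
   the sumset fits under it. *)
move=> t0A mA; exists [multinom if i \in A then m i else l * d | i < n].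
split=> [j jA|u uA [b Bb /mnm_lepP ble]].
  have [a Ba ea] := mpow_loc_lift (mA _ jA); exists a => //.
  apply/mnm_lepP => i; rewrite mnmDE mnmE; case: ifP => iA.
    by have := congr1 (fun m : 'X_{1..n} => m i) ea; rewrite restrictE iA mnmDE => ->.
  rewrite -(equigen_mpow Bd Ba) mdegE (bigD1 i) //=; lia.
have h1 := wt_mpow_ge mu_le Bb.
have h2 := equigen_mpow equigen_loc (mA _ t0A); rewrite mdegD mdeg1 in h2.
suff : wt wA b <= mdeg m by lia.
rewrite mdegE; apply: leq_sum => i _; rewrite /wA; case: (boolP (i \in A)) => iA //.
by rewrite mul1n; have := ble i; rewrite mnmDE mnmE iA uA // addn0.
Qed.

End Localization.

(** Connectedness of the localization does not mention the power: it is read off at [l] and used at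
    [l']. *)
Lemma ass_witness_stable A l l' : 0 < l' -> n - #|components B| <= l' ->
  (exists w, ass_witness (mpow B l) A w) -> exists w, ass_witness (mpow B l') A w.
Proof.
move=> l'0 l'k [w wP]; pose wA := fun i => i \in A : nat.
have [mu [mu_le mu_ex]] : exists mu, (forall a, B a -> mu <= wt wA a) /\
    exists2 a, B a & wt wA a = mu.
  have [a0 Ba0] := B0; have [N] := ubnP (wt wA a0); elim: N a0 Ba0 => // N IH a Ba aN.
  case: (pselect (exists2 c, B c & wt wA c < wt wA a)) => [[c Bc lc]|h].
    by apply: (IH c) => //; lia.
  exists (wt wA a); split=> [c Bc|]; last by exists a.
  by rewrite leqNgt; apply/negP => lc; apply: h; exists c.
have [t0 t0A [apos conn]] := ass_witness_loc mu_le mu_ex wP.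
have cA : #|A|.-1 <= l'.
  apply: leq_trans l'k; apply: card_connected => i j iA jA.
  apply: connect_sub (conn _ _ iA jA) => x y /= /andP[_ /asboolP xy].
  by have [->//|h] := adj_loc mu_le xy; apply/connect1/asboolP.
have [m mA] := socle_exists t0A apos conn l'0 cA.
exact: (loc_ass_witness mu_le t0A mA).
Qed.

End AssStability.

Section Astab.
Local Open Scope ring_scope.
Variables (K : fieldType) (n d : nat) (B : 'X_{1..n} -> Prop).
Hypotheses (Bd : equigenerated d B) (Bx : exchange B) (B0 : exists a, B a).

Lemma associated_prime_stable (P : {pred {mpoly K[n]}}) l l' : (0 < l')%N ->
  (n - #|components B| <= l')%N ->
  associated_prime (mideal (mpow B l)) P -> associated_prime (mideal (mpow B l')) P.
Proof.
move=> l'0 l'k /associated_mideal[A [PA wA]].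
have [w wP] := ass_witness_stable Bd Bx B0 l'0 l'k wA.
have [[[Q0 Q1 Q2] Qp] [f fP]] := var_prime_associated K wP.
split; last by exists f => g; rewrite PA fP.
split; last by move=> u v; rewrite !PA; apply: Qp.
by split; rewrite ?PA // => a u v; rewrite !PA; apply: Q2.
Qed.

End Astab.

(** * Koszul homology and regular sequences *)

Section Koszul.
Local Open Scope ring_scope.
Variable R : comNzRingType.
Implicit Types (xs cs : seq R) (z y v : seq bool -> R) (T U : seq bool) (J : {pred R}) (p : nat).

(* Elements of the exterior algebra on the generators e_i are functions z on
   subsets of the index set, encoded as bit sequences; kd is the contraction
   e_i |-> x_i and kw the left multiplication by the sum of the c_i e_i. *)
Fixpoint kd xs z T : R :=
  match xs, T with
  | x :: xs', false :: T' => kd xs' (fun U => z (false :: U)) T' + x * z (true :: T')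
  | x :: xs', true :: T' => - kd xs' (fun U => z (true :: U)) T'
  | _, _ => 0
  end.

Fixpoint kw cs z T : R :=
  match cs, T with
  | c :: cs', false :: T' => kw cs' (fun U => z (false :: U)) T'
  | c :: cs', true :: T' => c * z (false :: T') - kw cs' (fun U => z (true :: U)) T'
  | _, _ => 0
  end.

Definition card_bits T : nat := count id T.

Lemma card_bits_cons b T : card_bits (b :: T) = (b + card_bits T)%N.
Proof. by []. Qed.

Lemma kd_ext xs z y T :
  (forall U, size U = size xs -> card_bits U = (card_bits T).+1 -> z U = y U) ->
  size T = size xs -> kd xs z T = kd xs y T.
Proof.
elim: xs z y T => [|x xs IH] z y [|[] T] //= h [sT]; last congr (_ + _ * _).
- by congr (- _); apply: IH => // U sU cU; apply: h; rewrite ?card_bits_cons /= ?sU // cU.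
- by apply: IH => // U sU cU; apply: h; rewrite ?card_bits_cons /= ?sU // cU.
by apply: h; rewrite ?card_bits_cons /= ?sT.
Qed.

Lemma kd_eq xs z y T : z =1 y -> kd xs z T = kd xs y T.
Proof.
move=> zy; elim: xs z y zy T => [|x xs IH] z y zy [|[] T] //=.
  by congr (- _); apply: IH => U; apply: zy.
by congr (_ + _ * _); [apply: IH => U|]; apply: zy.
Qed.

Lemma kw_eq cs z y T : z =1 y -> kw cs z T = kw cs y T.
Proof.
move=> zy; elim: cs z y zy T => [|c cs IH] z y zy [|[] T] //=.
  by congr (_ * _ - _); [|apply: IH => U]; apply: zy.
by apply: IH => U; apply: zy.
Qed.

Lemma kd_lin xs a z y T :
  kd xs (fun U => a * z U + y U) T = a * kd xs z T + kd xs y T.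
Proof.
elim: xs z y T => [|x xs IH] z y [|[] T] /=; rewrite ?IH; ring.
Qed.

Lemma kw_lin cs a z y T :
  kw cs (fun U => a * z U + y U) T = a * kw cs z T + kw cs y T.
Proof.
elim: cs z y T => [|c cs IH] z y [|[] T] /=; rewrite ?IH; ring.
Qed.

Lemma kdN xs z T : kd xs (fun U => - z U) T = - kd xs z T.
Proof.
by elim: xs z T => [|x xs IH] z [|[] T] /=; rewrite ?oppr0 ?IH ?mulrN ?opprD.
Qed.

Lemma kwN cs z T : kw cs (fun U => - z U) T = - kw cs z T.
Proof.
elim: cs z T => [|c cs IH] z [|[] T] /=; rewrite ?oppr0 ?IH //; ring.
Qed.

Lemma kd_kd xs z T : kd xs (kd xs z) T = 0.
Proof.
elim: xs z T => [|x xs IH] z [|[] T] //=; first by rewrite kdN IH !oppr0.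
have -> : kd xs (fun U => kd xs (fun U0 => z (false :: U0)) U + x * z (true :: U)) T =
          kd xs (fun U => x * z (true :: U) + kd xs (fun U0 => z (false :: U0)) U) T.
  by apply: kd_eq => U; rewrite addrC.
by rewrite kd_lin IH; ring.
Qed.

(** The homotopy formula: contraction is an antiderivation, so multiplication by the sum of the
    [c_i x_i] is null-homotopic. *)
Lemma kd_kw xs cs z T : size xs = size T -> size cs = size T ->
  kd xs (kw cs z) T + kw cs (kd xs z) T = (\sum_(cx <- zip cs xs) cx.1 * cx.2) * z T.
Proof.
elim: xs cs z T => [|x xs IH] [|c cs] z [|[] T] //=; rewrite ?big_nil ?mul0r ?addr0 //.
  move=> [sx] [sc]; rewrite big_cons /= kwN.
  rewrite (kd_lin xs c (fun U => z (false :: U))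
    (fun U => - kw cs (fun U0 => z (true :: U0)) U)) kdN.
  have := IH _ (fun U => z (true :: U)) _ sx sc.
  move=> /(canRL (addrK _)) ->. ring.
move=> [sx] [sc]; rewrite big_cons /=.
rewrite (@kw_eq _ (fun U => kd xs (fun U0 => z (false :: U0)) U + x * z (true :: U))
  (fun U => x * z (true :: U) + kd xs (fun U0 => z (false :: U0)) U)); last first.
  by move=> U; rewrite addrC.
rewrite kw_lin; have := IH _ (fun U => z (false :: U)) _ sx sc.
move=> /(canRL (addrK _)) ->; ring.
Qed.

Lemma kd_in J (iJ : is_ideal J) xs z T :
  (forall U, size U = size xs -> card_bits U = (card_bits T).+1 -> z U \in J) ->
  size T = size xs -> kd xs z T \in J.
Proof.
have J0 := is_ideal0 iJ.
elim: xs z T => [|x xs IH] z [|[] T] //= h [sT].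
  apply: is_idealN => //; apply: IH => // U sU cU.
  by apply: h; rewrite ?card_bits_cons /= ?sU // cU.
apply: is_idealD => //.
  by apply: IH => // U sU cU; apply: h; rewrite ?card_bits_cons /= ?sU // cU.
by apply: is_idealMl => //; apply: h; rewrite ?card_bits_cons /= ?sT.
Qed.

Lemma kw_in J (iJ : is_ideal J) cs z T :
  (forall U, size U = size cs -> (card_bits U).+1 = card_bits T -> z U \in J) ->
  size T = size cs -> kw cs z T \in J.
Proof.
have J0 := is_ideal0 iJ.
elim: cs z T => [|c cs IH] z [|[] T] //= h [sT].
  apply: is_idealB => //.
    by apply: is_idealMl => //; apply: h; rewrite ?card_bits_cons /= ?sT.
  by apply: IH => // U sU cU; apply: h; rewrite ?card_bits_cons /= ?sU // -cU !add1n.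
by apply: IH => // U sU cU; apply: h; rewrite ?card_bits_cons /= ?sU // cU.
Qed.

Lemma kd_annihilated J (iJ : is_ideal J) xs z T :
  (forall x U, x \in xs -> x * z U \in J) -> kd xs z T \in J.
Proof.
have J0 := is_ideal0 iJ.
elim: xs z T => [|x xs IH] z [|[] T] //= h.
  apply: is_idealN => //; apply: IH => y U yxs.
  by apply: h; rewrite inE yxs orbT.
apply: is_idealD => //; last by apply: h; rewrite mem_head.
by apply: IH => y U yxs; apply: h; rewrite inE yxs orbT.
Qed.

(** Nothing lies above the top degree, so it contains no nonzero boundary. *)
Lemma kd_top xs z : kd xs z (nseq (size xs) true) = 0.
Proof. by elim: xs z => //= x xs IH z; rewrite IH oppr0. Qed.

Section Vanishing.
Variable xs : seq R.
Let n := size xs.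

(* Vanishing of the p-th Koszul homology of R/J *)
Definition koszul0 J p : Prop := forall z,
  (forall T, size T = n -> (card_bits T).+1 = p -> kd xs z T \in J) ->
  exists v, forall T, size T = n -> card_bits T = p -> z T - kd xs v T \in J.

Variables (J J' : {pred R}) (f : R).
Hypotheses (iJ : is_ideal J) (iJ' : is_ideal J').
Hypothesis J'E : forall h, h \in J' <-> exists j u, j \in J /\ h = j + f * u.
Hypothesis freg : forall g, f * g \in J -> g \in J.

Let JJ' h : h \in J -> h \in J'.
Proof. by move=> hJ; apply/J'E; exists h, 0; rewrite mulr0 addr0. Qed.

Let choose (Q : seq bool -> Prop) w : (forall T, Q T -> w T \in J') ->
  exists j u, forall T, Q T -> j T \in J /\ w T = j T + f * u T.
Proof.
move=> h; have /choice[j jP] : forall T, exists jT, Q T ->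
    jT \in J /\ exists u, w T = jT + f * u.
  move=> T; case: (pselect (Q T)) => [/h/J'E[jT [u [? ?]]]|nQ]; last by exists 0.
  by exists jT => _; split=> //; exists u.
have /choice[u uP] : forall T, exists u, Q T -> w T = j T + f * u.
  move=> T; case: (pselect (Q T)) => [QT|nQ]; last by exists 0.
  by have [_ [u uE]] := jP _ QT; exists u.
by exists j, u => T QT; split; [case: (jP _ QT)|apply: uP].
Qed.

(** For a cycle [z] modulo [J], the boundary of [kw cs z] is [f * z] modulo [J], so [kw cs z] is a
    cycle modulo [J']. Writing it as a boundary plus [f * u] modulo [J] and applying [kd] gives
    [f * z] equal to [f * kd xs u] modulo [J]; then [f] cancels. *)
Lemma koszul0_down p cs : size cs = n -> f = \sum_(cx <- zip cs xs) cx.1 * cx.2 ->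
  koszul0 J' p.+1 -> koszul0 J p.
Proof.
move=> scs fE van z zcyc.
have hom T : size T = n -> kd xs (kw cs z) T = f * z T - kw cs (kd xs z) T.
  by move=> sT; rewrite fE -(kd_kw z (xs := xs)) ?addrK ?sT ?scs.
have wJ T : size T = n -> card_bits T = p -> kw cs (kd xs z) T \in J.
  move=> sT cT; apply: kw_in => //; last by rewrite sT scs.
  by move=> U sU cU; apply: zcyc; rewrite ?sU // cU.
have [|v vP] := van (kw cs z).
  move=> T sT [cT]; rewrite hom //; apply: is_idealB => //; last exact/JJ'/wJ.
  by apply/J'E; exists 0, (z T); rewrite is_ideal0 // add0r.
have [j [u juP]] := @choose (fun T => size T = n /\ card_bits T = p.+1)
  (fun T => kw cs z T - kd xs v T) (fun T H => vP T H.1 H.2).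
exists u => T sT cT; apply: freg.
have e : kd xs (kw cs z) T = f * kd xs u T + kd xs j T.
  transitivity (kd xs (fun U => 1 * kd xs v U + (f * u U + j U)) T).
    apply: kd_ext => // U sU; rewrite cT => cU.
    by have [_ /(canRL (subrK _)) ->] := juP U (conj sU cU); ring.
  by rewrite !kd_lin kd_kd; ring.
rewrite mulrBr; have -> : f * z T = kd xs (kw cs z) T + kw cs (kd xs z) T.
  by rewrite hom // subrK.
rewrite e addrAC [f * _ + _]addrC addrK; apply: is_idealD => //; last exact: wJ.
apply: kd_in => // U sU; rewrite cT => cU.
by case: (juP U).
Qed.

(** A piece of the long exact sequence for multiplication by [f]. The boundary of [z] is [f * u]
    modulo [J]; cancelling [f] makes [u] a cycle, hence the boundary of some [v], and then
    [z - f * v] is a cycle modulo [J]. *)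
Lemma koszul0_up p : koszul0 J p.+1 -> koszul0 J p -> koszul0 J' p.+1.
Proof.
move=> van1 van z zcyc.
have [j [u juP]] := @choose (fun T => size T = n /\ card_bits T = p)
  (kd xs z) (fun T H => zcyc T H.1 (congr1 S H.2)).
have [|v vP] := van u.
  move=> T sT cT; apply: freg; have := kd_kd xs z T.
  rewrite (@kd_ext _ _ (fun U => f * u U + j U)) // => [|U sU]; last first.
    by rewrite cT => cU; have [_ ->] := juP U (conj sU cU); rewrite addrC.
  rewrite kd_lin => /eqP; rewrite addr_eq0 => /eqP ->; apply: is_idealN => //.
  by apply: kd_in => // U sU; rewrite cT => cU; case: (juP U).
have [|v' v'P] := van1 (fun T => (- f) * v T + z T).
  move=> T sT [cT]; rewrite kd_lin; have [jJ ->] := juP T (conj sT cT).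
  have -> : - f * kd xs v T + (j T + f * u T) = j T + f * (u T - kd xs v T) by ring.
  by apply: is_idealD => //; apply: is_idealMl => //; apply: vP.
exists v' => T sT cT; apply/J'E; exists (- f * v T + z T - kd xs v' T), (v T).
by split; [apply: v'P|ring].
Qed.

Lemma koszul0_up0 : koszul0 J 0 -> koszul0 J' 0.
Proof.
move=> van z _; have [//|v vP] := van z.
by exists v => T sT cT; apply/JJ'/vP.
Qed.

End Vanishing.

Lemma is_ideal_add J fs : is_ideal (ideal_add J fs).
Proof. exact: is_ideal_gen. Qed.

Lemma ideal_add_sub J fs : {subset J <= ideal_add J fs}.
Proof. by move=> h hJ; apply: ideal_gen_sub; rewrite inE hJ. Qed.

Lemma ideal_add_mem J fs : {subset fs <= ideal_add J fs}.
Proof. by move=> h hf; apply: ideal_gen_sub; rewrite inE hf orbT. Qed.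

Lemma ideal_add_le J fs J' : is_ideal J' -> {subset J <= J'} -> {subset fs <= J'} ->
  {subset ideal_add J fs <= J'}.
Proof.
move=> iJ' JJ' fJ'; apply: ideal_gen_le => // g; rewrite inE.
by case/orP; [apply: JJ'|apply: fJ'].
Qed.

Lemma ideal_add_take J fs i h : (i < size fs)%N ->
  h \in ideal_add J (take i.+1 fs) <->
  exists j u, j \in ideal_add J (take i fs) /\ h = j + fs`_i * u.
Proof.
move=> ifs; rewrite (take_nth 0) //; split; last first.
  case=> j [u [jJ ->]]; apply: is_idealD; first exact: is_ideal_add.
    move: jJ; apply: ideal_add_le; [exact: is_ideal_add|exact: ideal_add_sub|].
    by move=> g gf; apply: ideal_add_mem; rewrite mem_rcons inE gf orbT.
  rewrite mulrC; apply: is_idealMl; first exact: is_ideal_add.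
  by apply: ideal_add_mem; rewrite mem_rcons mem_head.
pose J' : {pred R} := fun h =>
  `[< exists j u, j \in ideal_add J (take i fs) /\ h = j + fs`_i * u >].
have iJ := is_ideal_add J (take i fs).
suff sub : {subset ideal_add J (rcons (take i fs) fs`_i) <= J'} by move/sub/asboolP.
apply: ideal_add_le.
- split=> [|_ _ /asboolP[j1 [u1 [h1 ->]]] /asboolP[j2 [u2 [h2 ->]]]|
           a _ /asboolP[j [u [hj ->]]]]; apply/asboolP.
  + by exists 0, 0; rewrite mulr0 addr0 is_ideal0.
  + by exists (j1 + j2), (u1 + u2); split; [apply: is_idealD|ring].
  + by exists (a * j), (a * u); split; [apply: is_idealMl|ring].
- by move=> g gJ; apply/asboolP; exists g, 0; rewrite mulr0 addr0 ideal_add_sub.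
move=> g; rewrite mem_rcons inE => /orP[/eqP->|gf]; apply/asboolP.
  by exists 0, 1; rewrite is_ideal0 // add0r mulr1.
by exists g, 0; rewrite mulr0 addr0 ideal_add_mem.
Qed.

(* A regular sequence of length t forces the Koszul homology of R/J to vanish in
   degrees > n - t, and vanishing in degrees >= n - size gs ascends along gs to
   vanishing in degree n, which the socle element u contradicts. *)
Lemma regular_seq_size (M J : {pred R}) (xs fs gs : seq R) u :
  (forall f, f \in M -> exists2 cs, size cs = size xs & f = \sum_(cx <- zip cs xs) cx.1 * cx.2) ->
  regular_seq M J gs -> u \notin ideal_add J gs ->
  {in xs, forall x, x * u \in ideal_add J gs} ->
  regular_seq M J fs -> (size fs <= size gs)%N.
Proof.
move=> Mxs [_ _ greg] uJ ux [fM _ freg]; rewrite leqNgt; apply/negP => lt.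
have down k : (k <= size fs)%N -> forall p, (size xs < p + k)%N ->
    koszul0 xs (ideal_add J (take (size fs - k) fs)) p.
  elim: k => [|k IH] kf p pk.
    (* No subset has more than [size xs] elements, so there is nothing to check in these degrees. *)
    move=> z _; exists (fun=> 0) => T sT cT.
    by have := count_size id T; rewrite -/(card_bits T) cT sT; lia.
  have lt_k : (size fs - k.+1 < size fs)%N by lia.
  have [cs scs fE] := Mxs _ (fM _ (mem_nth 0 lt_k)).
  have e : (size fs - k)%N = (size fs - k.+1).+1 by lia.
  apply: (koszul0_down (J' := ideal_add J (take (size fs - k) fs)) _ _ _ (freg _ lt_k) scs fE).
  - exact: is_ideal_add.
  - exact: is_ideal_add.
  - by move=> h; rewrite e; apply: ideal_add_take.
  by apply: IH; lia.
have upw i : (i <= size gs)%N -> forall p, (size xs + i <= p + size gs)%N ->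
    koszul0 xs (ideal_add J (take i gs)) p.
  elim: i => [|i IH] ig p pk.
    have := down (size fs) (leqnn _) p; rewrite subnn !take0; apply; lia.
  have iJi := is_ideal_add J (take i gs); have iJi1 := is_ideal_add J (take i.+1 gs).
  have E h := ideal_add_take J h ig.
  case: p pk => [|p] pk.
    by apply: (koszul0_up0 E); apply: IH; lia.
  by apply: (koszul0_up iJi E (greg _ ig)); apply: IH; lia.
have iG := is_ideal_add J gs.
have := upw (size gs) (leqnn _) (size xs) (leqnn _); rewrite take_size.
(* The socle element placed on the full subset is a cycle, being killed by all of [xs], but the top
   degree has no nonzero boundary. *)
move=> /(_ (fun T => if T == nseq (size xs) true then u else 0)) [].
  move=> T _ _; apply: kd_annihilated => // x U xxs.
  by case: eqP => _; [apply: ux|rewrite mulr0 is_ideal0].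
move=> v /(_ (nseq (size xs) true)); rewrite size_nseq eqxx kd_top subr0.
by rewrite /card_bits count_nseq mul1n => /(_ erefl erefl); rewrite (negbTE uJ).
Qed.

End Koszul.

(** * Depth of the powers *)

Section VariableDifference.
Local Open Scope ring_scope.
Variables (K : fieldType) (n : nat) (C : 'X_{1..n} -> Prop).
Implicit Types (h : {mpoly K[n]}) (p q : 'I_n) (u m : 'X_{1..n}).

Lemma mcoeffMXU h p m : (h * 'X_p)@_m = if (0 < m p)%N then h@_(m - U_(p))%MM else 0.
Proof.
case: ifP => [mp|/negbT]; first by rewrite -{1}(mnmU mp) addmC mcoeffMX.
rewrite -leqNgt leqn0 => /eqP mp; apply/eqP; rewrite mcoeff_eq0 (perm_mem (msuppMX _ _)).
by apply/negP => /mapP[w _ e]; move: mp; rewrite e mnmDE mnm1E eqxx.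
Qed.

(* The coefficient of x_q u in (x_p - x_q) h is h_(x_q u / x_p) - h_u, so a
   nonzero h_u propagates to ever smaller exponents of x_p. *)
Lemma coef_descent p q h u : p != q -> ('X_p - 'X_q) * h \in mideal C ->
  (forall j, ~ up C (u + U_(q) *+ j)%MM) -> h@_u = 0.
Proof.
move=> pq /midealP hC; have [N] := ubnP (u p); elim: N u => // N IH u uN nup.
apply/eqP; apply: contraT => hu.
have : (('X_p - 'X_q) * h)@_(u + U_(q))%MM == 0.
  by apply: contraT => /hC; have := nup 1%N; rewrite mulm1n.
have qp : (q == p) = false by rewrite eq_sym (negbTE pq).
rewrite mulrBl mcoeffB ![_ * h]mulrC !mcoeffMXU !mnmDE !mnm1E eqxx addn1 /= addmK.
rewrite qp addn0; case: ifP => [up0|_]; last first.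
  by rewrite sub0r oppr_eq0 (negbTE hu).
rewrite IH ?sub0r ?oppr_eq0 ?(negbTE hu) //.
  by rewrite mnmBE mnmDE !mnm1E eqxx qp; lia.
move=> j /(up_add U_(p)).
have -> : ((u + U_(q) - U_(p)) + U_(q) *+ j + U_(p) = u + U_(q) *+ j.+1)%MM.
  apply/mnmP => i; rewrite !(mnmDE, mnmBE, mulmnE, mnm1E).
  by case: (p =P i) => [<-|_]; rewrite ?qp; nia.
exact: nup.
Qed.

(** A monomial outside the ideal stays outside under all powers of one of the two variables, and
    [coef_descent] in the matching order kills its coefficient. *)
Lemma var_sub_regular p q h : p != q ->
  (forall u i j, up C (u + U_(p) *+ i)%MM -> up C (u + U_(q) *+ j)%MM -> up C u) ->
  ('X_p - 'X_q) * h \in mideal C -> h \in mideal C.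
Proof.
move=> pq Cpq hC; apply/midealP => u; apply: contra_neqP => nup.
case: (pselect (exists i, up C (u + U_(p) *+ i)%MM)) => [[i Ci]|/forallNP nCp].
  by apply: (coef_descent pq hC) => j /(Cpq _ _ _ Ci).
apply: (@coef_descent q p h u _ _ nCp); first by rewrite eq_sym.
by rewrite -opprB mulNr; apply: is_idealN hC; apply: is_ideal_mideal.
Qed.

End VariableDifference.

(** * Identification of variables *)

Section Merge.
Local Open Scope ring_scope.
Variables (K : fieldType) (n : nat) (f : 'I_n -> 'I_n).
Local Notation S := {mpoly K[n]}.
Implicit Types (a b m : 'X_{1..n}) (C : 'X_{1..n} -> Prop) (h : S).

Definition push a : 'X_{1..n} := (\sum_j U_(f j) *+ a j)%MM.

Definition push_set C m := exists2 a, C a & m = push a.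

Definition merge h : S := h \mPo [tuple 'X_(f i) | i < n].

Lemma pushE a i : push a i = (\sum_(j | f j == i) a j)%N.
Proof.
rewrite mnm_sumE [RHS]big_mkcond; apply: eq_bigr => j _.
by rewrite mulmnE mnm1E; case: eqP; rewrite ?mul1n ?mul0n.
Qed.

Lemma pushD a b : push (a + b)%MM = (push a + push b)%MM.
Proof.
apply/mnmP => i; rewrite mnmDE !pushE -big_split.
by apply: eq_bigr => j _; rewrite mnmDE.
Qed.

Lemma push0 : push 0%MM = 0%MM.
Proof. by apply/mnmP => i; rewrite pushE mnm0E big1 // => j _; rewrite mnm0E. Qed.

Lemma pushU i : push U_(i)%MM = U_(f i)%MM.
Proof.
apply/mnmP => j; rewrite pushE mnm1E; case: eqP => [e|ne].
  rewrite (bigD1 i) /= ?e // mnm1E eqxx big1 // => k /andP[_ ki].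
  by rewrite mnm1E eq_sym (negbTE ki).
by rewrite big1 // => k /eqP e; rewrite mnm1E; case: eqP => // ik; case: ne; rewrite ik.
Qed.

Lemma mdeg_push a : mdeg (push a) = mdeg a.
Proof.
rewrite /push mdeg_sum mdegE; apply: eq_bigr => j _.
by rewrite mdegMn mdeg1 mul1n.
Qed.

Lemma mergeX m : merge 'X_[m] = 'X_[push m].
Proof.
rewrite /merge comp_mpolyX /push (big_morph _ (@mpolyXD n K) (@mpolyX0 n K)).
apply: eq_bigr => i _.
by rewrite tnth_mktuple mpolyXn.
Qed.

Lemma mpow_push_set C l m : mpow (push_set C) l m -> push_set (mpow C l) m.
Proof.
move: m; apply: (mpow_map (R := fun m a => m = push a)) => [|a b a' b' -> ->|_ [a Ca ->]].
- by rewrite push0.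
- by rewrite pushD.
by exists a.
Qed.

Section Membership.
Variables (J : {pred S}) (iJ : is_ideal J).
Hypothesis Jf : forall i, 'X_i - 'X_(f i) \in J.

(** One variable is replaced at a time. *)
Lemma sub_pushX m : 'X_[m] - 'X_[push m] \in J.
Proof.
have [N] := ubnP (mdeg m); elim: N m => // N IH m mN.
have [[i mi]|m0] := pselect (exists i, (0 < m i)%N); last first.
  have -> : m = 0%MM.
    apply/mnmP => i; rewrite mnm0E; apply/eqP; rewrite -leqn0 leqNgt.
    by apply/negP => mi; apply: m0; exists i.
  by rewrite push0 subrr is_ideal0.
have degm : (mdeg (m - U_(i))%MM < mdeg m)%N.
  by rewrite -{2}(mnmU mi) mdegD mdeg1 addn1.
rewrite -(mnmU mi) pushD pushU !mpolyXD.
set m' := (m - U_(i))%MM in degm *.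
have -> : 'X_[m'] * 'X_i - 'X_[push m'] * 'X_(f i) =
  'X_[m'] * ('X_i - 'X_(f i)) + 'X_(f i) * ('X_[m'] - 'X_[push m']) :> S by ring.
apply: is_idealD => //; apply: is_idealMl => //.
by apply: IH; apply: leq_trans degm _.
Qed.

Lemma sub_merge h : h - merge h \in J.
Proof.
rewrite /merge comp_mpolyEX {1}[h]mpolyE -sumrB.
apply: is_ideal_sum => // m _; rewrite -scalerBr -mul_mpolyC.
by apply: is_idealMl => //; rewrite -/(merge 'X_[m]) mergeX; apply: sub_pushX.
Qed.

End Membership.

Definition merge_preim (J : {pred S}) : {pred S} := fun h => merge h \in J.

Lemma merge_preimE J h : (h \in merge_preim J) = (merge h \in J).
Proof. by []. Qed.

Lemma is_ideal_merge_preim (J : {pred S}) : is_ideal J -> is_ideal (merge_preim J).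
Proof.
move=> iJ; split=> [|u v|a u]; rewrite !merge_preimE /merge.
- by rewrite raddf0 is_ideal0.
- by rewrite raddfD; apply: is_idealD.
by rewrite rmorphM; apply: is_idealMl.
Qed.

End Merge.

Section MergeSequence.
Local Open Scope ring_scope.
Variables (K : fieldType) (n : nat) (y1 : 'I_n).
Local Notation S := {mpoly K[n]}.
Implicit Types (s : seq 'I_n) (h : S) (C : 'X_{1..n} -> Prop).

Definition merge_into s i : 'I_n := if i \in s then y1 else i.

Definition var_diffs s : seq S := [seq 'X_y - 'X_y1 | y <- s].

Lemma var_sub_merge C s i :
  'X_i - 'X_(merge_into s i) \in ideal_add (mideal (K := K) C) (var_diffs s).
Proof.
rewrite /merge_into; case: ifP => i_s; last by rewrite subrr is_ideal0 //; apply: is_ideal_add.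
exact/ideal_add_mem/map_f.
Qed.

Lemma push_set_ideal C s m : up (push_set (merge_into s) C) m ->
  'X_[m] \in ideal_add (mideal (K := K) C) (var_diffs s).
Proof.
have iI := is_ideal_add (mideal (K := K) C) (var_diffs s).
case=> [_ [a Ca ->] am]; rewrite (mpolyX_dvd _ am); apply: is_idealMl => //.
rewrite -['X_[push _ a]](subKr 'X_[a]); apply: is_idealB => //.
  by apply: ideal_add_sub; apply/midealX/up_self.
exact: sub_pushX iI (var_sub_merge C s) a.
Qed.

(** Modulo the differences the variables of [s] become that of [y1], so the quotient is again by a
    monomial ideal, that of the merged exponents. *)
Lemma ideal_add_var_diffs C s h : y1 \notin s ->
  (h \in ideal_add (mideal C) (var_diffs s)) =
  (merge (merge_into s) h \in mideal (push_set (merge_into s) C)).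
Proof.
move=> y1s; have iI := is_ideal_add (mideal (K := K) C) (var_diffs s).
have iP := is_ideal_mideal K (push_set (merge_into s) C).
apply/idP/idP => [|hP].
  apply: (ideal_add_le (is_ideal_merge_preim (merge_into s) iP)).
    move=> g; apply: (mideal_le (is_ideal_merge_preim (merge_into s) iP)) => a Ca.
    by rewrite merge_preimE mergeX; apply/midealX/up_self; exists a.
  move=> _ /mapP[y ys ->].
  rewrite merge_preimE /merge raddfB /= -/(merge _ 'X_[U_(y)]) -/(merge _ 'X_[U_(y1)]).
  rewrite !mergeX !pushU.
  by rewrite /merge_into ys (negbTE y1s) subrr is_ideal0.
rewrite -[h](subrK (merge (merge_into s) h)); apply: is_idealD => //.
  exact: sub_merge iI (var_sub_merge C s) h.
move: hP; apply: mideal_le => // m Cm; exact/push_set_ideal/up_self.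
Qed.

End MergeSequence.

Section Depth.
Local Open Scope ring_scope.
Variables (K : fieldType) (n d : nat) (B : 'X_{1..n} -> Prop).
Local Notation S := {mpoly K[n]}.
Hypotheses (Bd : equigenerated d B) (Bx : exchange B).
Implicit Types (s : seq 'I_n).

Lemma mix_closed_mpow l (U : {pred 'I_n}) a b :
  (forall i j, adj B i j -> (i \in U) = (j \in U)) -> mpow B l a -> mpow B l b ->
  exists2 c, mpow B l c & forall i, c i = if i \in U then b i else a i.
Proof.
move=> UB; elim: l a b => [|l IH] a b /=.
  by move=> -> ->; exists 0%MM => // i; rewrite mnm0E if_same.
move=> [a1 [a2 [Ba1 Ba2 ->]]] [b1 [b2 [Bb1 Bb2 ->]]].
have [c1 Bc1 c1E] := mix_closed Bd Bx UB Ba1 Bb1.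
have [c2 Bc2 c2E] := IH _ _ Ba2 Bb2.
exists (c1 + c2)%MM; first by exists c1, c2.
by move=> i; rewrite !mnmDE c1E c2E; case: ifP.
Qed.

Lemma mmax_span (h : S) : h \in @mmax K n -> exists c : 'I_n -> S, h = \sum_i c i * 'X_i.
Proof.
pose J : {pred S} := fun h => `[< exists c : 'I_n -> S, h = \sum_i c i * 'X_i >].
suff sub : {subset @mmax K n <= J} by move/sub/asboolP.
apply: ideal_gen_le.
  split=> [|_ _ /asboolP[c ->] /asboolP[e ->]|a _ /asboolP[c ->]]; apply/asboolP.
  - by exists (fun=> 0); rewrite big1 // => i _; rewrite mul0r.
  - by exists (fun i => c i + e i); rewrite -big_split; apply: eq_bigr => i _; rewrite mulrDl.
  by exists (fun i => a * c i); rewrite mulr_sumr; apply: eq_bigr => i _; rewrite mulrA.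
move=> g; rewrite inE => /existsP[i /eqP ->]; apply/asboolP.
exists (fun j => (j == i)%:R); rewrite (bigD1 i) //= eqxx mul1r big1 ?addr0 // => j /negbTE ->.
by rewrite mul0r.
Qed.

Lemma var_mmax i : 'X_i \in @mmax K n.
Proof. by apply: ideal_gen_sub; rewrite inE; apply/existsP; exists i. Qed.

Lemma root_components i : fingraph.root (adjr B) i \in components B.
Proof. by rewrite inE; apply: roots_root; apply: adjr_sym. Qed.

(** The lower bound is the regular sequence [gs]; the upper bound comes from a socle element modulo
    it, through [regular_seq_size]. *)
Lemma depth_mpow l : (0 < d)%N -> (exists a, B a) -> (0 < l)%N -> (n - #|components B| <= l)%N ->
  depth_quot (mideal (K := K) (mpow B l)) (#|components B|.-1).
Proof.
move=> d0 [a0 Ba0] l0 lk.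
have [t0 at0] : exists t0, (0 < a0 t0)%N.
  apply: contrapT => /forallNP h; move: (Bd Ba0); rewrite mdegE big1; first by lia.
  by move=> i _; have /negP := h i; lia.
pose y1 := fingraph.root (adjr B) t0.
pose ys := [seq y <- enum (components B) | y != y1].
have y1c : y1 \in components B by apply: root_components.
have sys : size ys = #|components B|.-1.
  have := count_predC (pred1 y1) (enum (components B)).
  rewrite count_uniq_mem ?enum_uniq // mem_enum y1c -cardE => <-.
  by rewrite add1n size_filter.
have root_ys y : y \in ys -> fingraph.root (adjr B) y = y /\ y != y1.
  by rewrite mem_filter mem_enum inE => /andP[yy1 /eqP ->].
have y1ys : y1 \notin ys by apply/negP => /root_ys [_]; rewrite eqxx.
have root_y1 : fingraph.root (adjr B) y1 = y1 by apply: root_root; apply: adjr_sym.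
pose J := mideal (K := K) (mpow B l); pose gs := var_diffs K y1 ys.
have take_gs i : take i gs = var_diffs K y1 (take i ys) by rewrite /gs /var_diffs map_take.
(* Merging all roots into [y1] glues the components together; at most n - c + 1 vertices remain, c
   being the number of components, and [socle_exists] applies. *)
have [m mT] : exists m, forall k,
    mpow (push_set (merge_into y1 ys) B) l (m + U_(merge_into y1 ys k))%MM.
  pose f := merge_into y1 ys; pose T := [set f k | k : 'I_n].
  have fT k : f k \in T by apply: imset_f.
  have [||//||m mT] := @socle_exists _ (push_set f B) T l (f t0) (fT t0).
  - by exists (push f a0); [exists a0|rewrite pushE (bigD1 t0) //= addn_gt0 at0].
  - set e : rel 'I_n := [rel x y | _].
    have conn i j : connect (adjr B) i j -> connect e (f i) (f j).
      move=> /connectP[p]; elim: p i => [|k p IH] i /=; first by move=> _ ->.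
      move=> /andP[/asboolP[q qi qk] kp] lp; apply: connect_trans (IH _ kp lp).
      apply: connect1; rewrite /e /= fT; apply/asboolP.
      by exists (push f q); rewrite -pushU -pushD; [exists (q + U_(i))%MM|exists (q + U_(k))%MM].
    have froot k : f (fingraph.root (adjr B) k) = y1.
      rewrite /f /merge_into; case: ifPn => // h; apply/eqP; apply: contraNT h => h.
      by rewrite mem_filter h mem_enum root_components.
    move=> _ _ /imsetP[i _ ->] /imsetP[j _ ->]; apply: (@connect_trans _ _ y1).
      by rewrite -(froot i); apply/conn/connect_root.
    by rewrite -(froot j); apply: conn; rewrite adjr_sym; apply: connect_root.
  - apply: leq_trans lk; have : T \subset ~: [set y in ys].
      apply/subsetP => _ /imsetP[k _ ->]; rewrite !inE /f /merge_into.
      by case: ifPn.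
    move/subset_leq_card; have := cardsC [set y in ys]; rewrite card_ord cardsE.
    have /card_uniqP -> : uniq ys by rewrite filter_uniq // enum_uniq.
    have c0 : (0 < #|components B|)%N by apply/card_gt0P; exists y1.
    rewrite sys => e le; have cT : (#|components B|.-1 + #|T| <= n)%N.
      by apply: leq_trans (eq_leq e); rewrite leq_add2l.
    have aux x y : (0 < y)%N -> (y.-1 + x <= n)%N -> (x.-1 <= n - y)%N by lia.
    exact: aux c0 cT.
  by exists m => k; apply: mT.
have iG : is_ideal (ideal_add J gs) := is_ideal_add J gs.
(* The degree of [m] is one less than that of the merged generators. *)
have socle_notin : 'X_[m] \notin ideal_add J gs.
  rewrite ideal_add_var_diffs // mergeX; apply/negP => /midealX[_ [a /(equigen_mpow Bd) degb ->]].
  move/(wt_lem (fun=> 1%N)); rewrite !wt1 !mdeg_push degb.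
  have /mpow_push_set[b /(equigen_mpow Bd) <- /(congr1 mdeg)] := mT y1.
  by rewrite mdegD mdeg1 mdeg_push; lia.
have greg : regular_seq (@mmax K n) J gs.
  split.
  - move=> _ /mapP[y _ ->]; apply: (is_idealB (is_ideal_gen _)); exact: var_mmax.
  - apply: contra socle_notin => one; rewrite -['X_[m]]mulr1.
    exact: is_idealMl.
  move=> i; rewrite size_map => ilt h.
  have y1t : y1 \notin take i ys by apply: contra y1ys => /mem_take.
  set y := nth y1 ys i; have y_ys : y \in ys by apply: mem_nth.
  have [ry yy1] := root_ys _ y_ys.
  have yt : y \notin take i ys.
    have uys : uniq ys by rewrite filter_uniq // enum_uniq.
    move: uys; rewrite -{1}(cat_take_drop i ys) cat_uniq => /and3P[_ /hasPn h1 _].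
    by apply: h1; rewrite (drop_nth y1 ilt) mem_head.
  rewrite take_gs !ideal_add_var_diffs // (nth_map y1) // -/y /merge rmorphM raddfB /=.
  rewrite -/(merge _ 'X_[U_(y)]) -/(merge _ 'X_[U_(y1)]) -/(merge _ h) !mergeX !pushU.
  rewrite {1 2}/merge_into (negbTE yt) (negbTE y1t).
  apply: var_sub_regular => // u a b [_ [c Bc ->] /mnm_lepP cu] [_ [e Be ->] /mnm_lepP eu].
  (* Take [e] on the component of [y] and [c] elsewhere. After merging, [e] can exceed [u] only at
     [y1], outside that component, and [c] only at [y], inside it. *)
  pose U : {pred 'I_n} := [pred k | fingraph.root (adjr B) k == y].
  have UB k k' : adj B k k' -> (k \in U) = (k' \in U).
    move=> kk'; rewrite !inE; congr (_ == y); apply/eqP; rewrite root_connect; last exact: adjr_sym.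
    by apply/connect1/asboolP.
  have [x Bx' xE] := mix_closed_mpow UB Bc Be.
  exists (push (merge_into y1 (take i ys)) x); first by exists x.
  have rt k : k \in take i ys -> fingraph.root (adjr B) k = k /\ k != y.
    move=> kt; have [-> _] := root_ys _ (mem_take kt); split=> //.
    by apply: contraNneq yt => <-.
  apply/mnm_lepP => k; case: (boolP (k \in U)) => kU.
    have kt : k \notin take i ys.
      apply/negP => /rt [rk /eqP ky]; apply: ky; move: kU; rewrite inE rk => /eqP //.
    have ky1 : k != y1.
      by apply: contraTneq kU => ->; rewrite inE root_y1 eq_sym.
    apply: (@leq_trans (push (merge_into y1 (take i ys)) e k)); last first.
      apply: leq_trans (eu k) _.
      by rewrite mnmDE mulmnE mnm1E eq_sym (negbTE ky1) mul0n addn0.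
    rewrite !pushE; apply: leq_sum => t /eqP; rewrite /merge_into; case: ifP => _ tk.
      by rewrite tk eqxx in ky1.
    by rewrite tk xE kU.
  apply: (@leq_trans (push (merge_into y1 (take i ys)) c k)); last first.
    apply: leq_trans (cu k) _; rewrite mnmDE mulmnE mnm1E.
    case: (y =P k) => [yk|_]; last by rewrite mul0n addn0.
    by move: kU; rewrite -yk inE ry eqxx.
  rewrite !pushE; apply: leq_sum => t /eqP; rewrite /merge_into xE; case: ifP => [ts tk|_ tk].
    by rewrite inE; have [-> /negbTE ->] := rt _ ts.
  by rewrite tk (negbTE kU).
split.
  by exists gs => //; rewrite size_map.
move=> r [fs <- freg]; rewrite -sys -(size_map (fun y => 'X_y - 'X_y1 : S)).
pose xs := [seq 'X_i : S | i <- enum 'I_n].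
apply: (regular_seq_size (xs := xs) _ greg socle_notin _ freg).
  move=> h /mmax_span[c ->]; exists [seq c i | i <- enum 'I_n]; rewrite ?size_map //.
  by rewrite zip_map big_map /= big_enum.
move=> _ /mapP[k _ ->].
(* Modulo the differences ['X_k] is the merged variable, whose product with ['X_[m]] is a merged
   generator. *)
rewrite -['X_k](subrK ('X_(merge_into y1 ys k))) mulrDl; apply: is_idealD => //.
  by apply: is_idealMr => //; apply: var_sub_merge.
by rewrite -mpolyXD addmC; apply/push_set_ideal/up_self/mpow_push_set.
Qed.

End Depth.

(** * Algebraic dependence and chains of primes *)

Section AlgebraicDependence.
Local Open Scope ring_scope.
Variables (K : fieldType) (n : nat).
Local Notation S := {mpoly K[n]}.
Implicit Types (f g : S).

Definition mdeg_le E f : Prop := forall m, m \in msupp f -> (mdeg m <= E)%N.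

Lemma mdeg_le1 : mdeg_le 0 (1 : S).
Proof. by move=> m; rewrite -mpolyX0 msuppX inE => /eqP ->; rewrite mdeg0. Qed.

Lemma mdeg_leM a b f g : mdeg_le a f -> mdeg_le b g -> mdeg_le (a + b)%N (f * g).
Proof.
move=> fa gb m /msuppM_le /allpairsP[[m1 m2] /= [/fa h1 /gb h2 ->]].
by rewrite mdegD leq_add.
Qed.

Lemma mdeg_leX a f k : mdeg_le a f -> mdeg_le (k * a)%N (f ^+ k).
Proof.
move=> fa; elim: k => [|k IH]; first by rewrite expr0; apply: mdeg_le1.
by rewrite exprS mulSn; apply: mdeg_leM.
Qed.

Lemma algebraic_dependence (g : 'I_n.+1 -> S) :
  exists D (q : {ffun 'I_n.+1 -> 'I_D} -> K),
    (exists e, q e != 0) /\ \sum_e q e *: \prod_i g i ^+ e i = 0.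
Proof.
have [E gE] : exists E, forall i, mdeg_le E (g i).
  exists (\max_i \max_(m <- msupp (g i)) mdeg m) => i m mi.
  by apply: leq_trans (leq_bigmax i); by rewrite (bigD1_seq m) ?msupp_uniq //= leq_maxl.
(* Products with exponents below [D] of polynomials of degree at most [E] involve only exponents
   below [M]. The choice of [D] makes the number [M ^ n] of such monomials smaller than the number
   [D ^ n.+1] of products. *)
pose D := ((n.+1 * E.+1) ^ n).+1; pose M := (n.+1 * E.+1 * D)%N.
pose X : finType := {ffun 'I_n.+1 -> 'I_D}; pose Y : finType := {ffun 'I_n -> 'I_M}.
pose P (e : X) : S := \prod_i g i ^+ e i.
pose mon (y : Y) : 'X_{1..n} := [multinom (y i : nat) | i < n].
pose A := \matrix_(i < #|X|, j < #|Y|) (P (enum_val i))@_(mon (enum_val j)).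
have cXY : (#|Y| < #|X|)%N.
  rewrite !card_ffun !card_ord /M expnMn [ltnRHS]expnS ltn_pmul2r ?expn_gt0 //.
have : kermx A != 0.
  rewrite -mxrank_eq0 mxrank_ker -lt0n subn_gt0.
  exact: leq_ltn_trans (rank_leq_col A) cXY.
case/rowV0Pn => v /sub_kermxP vA v0.
exists D, (fun e => v 0 (enum_rank e)); split.
  apply: contrapT => /forallNP h; case/eqP: v0; apply/rowP => i.
  by have /negP := h (enum_val i); rewrite negbK enum_valK mxE => /eqP.
apply/mpolyP => m; rewrite mcoeff0 raddf_sum /=.
case: (pselect (forall k, (m k < M)%N)) => [mM|nM]; last first.
  rewrite big1 // => e _; rewrite mcoeffZ -/(P e).
  have -> : (P e)@_m = 0; last by rewrite mulr0.
  apply/eqP; rewrite mcoeff_eq0; apply/negP => mP; apply: nM => k.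
  suff h : mdeg_le (\sum_i e i * E)%N (P e).
    have mk : (m k <= mdeg m)%N by rewrite mdegE (bigD1 k) //= leq_addr.
    apply: leq_ltn_trans mk (leq_ltn_trans (h _ mP) _).
    apply: (@leq_ltn_trans (\sum_(i < n.+1) D.-1 * E)%N).
      by apply: leq_sum => i _; rewrite leq_mul2r; apply/orP; right; rewrite -ltnS; apply: ltn_ord.
    rewrite sum_nat_const card_ord /M; nia.
  rewrite /P; elim/big_rec2: _ => [|i a f _ fa]; first exact: mdeg_le1.
  by apply: mdeg_leM => //; apply: mdeg_leX.
pose y : Y := [ffun k => Ordinal (mM k)].
have my : m = mon y by apply/mnmP => k; rewrite mnmE ffunE.
have := congr1 (fun B : 'rV_(_) => B 0 (enum_rank y)) vA; rewrite mxE [RHS]mxE => {2}<-.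
rewrite (reindex_onto enum_rank enum_val) /=; last by move=> i _; rewrite enum_valK.
under [RHS]eq_bigl do rewrite enum_rankK eqxx.
by apply: eq_bigr => e _; rewrite mcoeffZ mxE !enum_rankK my.
Qed.

End AlgebraicDependence.

(** * Chains of primes exclude algebraic relations *)

Section ChainBound.
Local Open Scope ring_scope.
Variables (R : comNzRingType) (T : finType) (N : nat).
Variables (c : nat -> {pred R}) (x : nat -> R) (e : T -> nat -> nat) (q : T -> R).
Hypothesis cprime : forall i, (i <= N)%N -> prime_ideal (c i).
Hypothesis csub : forall i, (i < N)%N -> {subset c i <= c i.+1}.
Hypothesis xc : forall i, (i < N)%N -> x i \in c i.+1 /\ x i \notin c i.
Hypothesis q_unit : forall t, q t != 0 -> exists u, u * q t = 1.
Hypothesis q_neq0 : exists t, q t != 0.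
Hypothesis e_inj : forall t t', (forall i, (i < N)%N -> e t i = e t' i) -> t = t'.

Let tail j t : R := \prod_(j <= i < N) x i ^+ e t i.

(* Following the lexicographically smallest exponent in the relation, the terms
   that survive modulo c j only involve x j, x j.+1, ...; at the end a unit lies
   in c N. *)
Lemma chain_no_relation : \sum_t q t * \prod_(0 <= i < N) x i ^+ e t i != 0.
Proof.
apply/eqP => rel0.
have key j : (j <= N)%N -> exists A : {set T}, [/\ A != set0,
    {in A, forall t, q t != 0},
    {in A &, forall t t', forall i, (i < j)%N -> e t i = e t' i} &
    \sum_(t in A) q t * tail j t \in c j].
  elim: j => [|j IH] jN.
    exists [set t | q t != 0]; split=> //.
    - by case: q_neq0 => t qt; apply/set0Pn; exists t; rewrite inE.
    - by move=> t; rewrite inE.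
    rewrite (_ : \sum_(t in _) _ = 0); first by case: (cprime jN) => [[]].
    rewrite -[RHS]rel0 [RHS](bigID (fun t => q t != 0)) /= [X in _ + X]big1 ?addr0.
      by apply: eq_bigl => t; rewrite inE.
    by move=> t; rewrite negbK => /eqP ->; rewrite mul0r.
  have [A [/set0Pn[t0 t0A] qA eA cA]] := IH (ltnW jN).
  (* The least power of [x j] is factored out and cancelled, since [x j] is not in the prime [c j];
     modulo [c j.+1] only the terms with this least exponent remain. *)
  have [t1 t1A t1min] := arg_minnP (fun t => e t j) t0A.
  have {}t1A : t1 \in A by [].
  exists [set t in A | e t j == e t1 j]; split.
  - by apply/set0Pn; exists t1; rewrite inE t1A eqxx.
  - by move=> t; rewrite inE => /andP[/qA].
  - move=> t t'; rewrite !inE => /andP[tA /eqP te] /andP[t'A /eqP t'e] i.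
    rewrite ltnS leq_eqVlt => /orP[/eqP ->|ij]; [by rewrite te t'e|exact: eA].
  have [icj pcj] := cprime (ltnW jN); have icj1 := idealr_closed_is_ideal (cprime jN).1.
  have [xj1 xj] := xc jN.
  have : x j ^+ e t1 j * \sum_(t in A) q t * (x j ^+ (e t j - e t1 j) * tail j.+1 t) \in c j.
    suff -> : x j ^+ e t1 j * \sum_(t in A) q t * (x j ^+ (e t j - e t1 j) * tail j.+1 t)
        = \sum_(t in A) q t * tail j t by [].
    rewrite mulr_sumr; apply: eq_bigr => t tA.
    rewrite /tail [in RHS]big_ltn // -[in RHS](subnKC (t1min _ tA)) exprD; ring.
  have xpow k : x j ^+ k \notin c j.
    elim: k => [|k IHk]; first by rewrite expr0; case: icj.
    by apply/negP; rewrite exprS => /pcj /orP[]; apply/negP.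
  move=> /pcj; rewrite (negbTE (xpow _)) /= => /(csub jN).
  rewrite (bigID (fun t => e t j == e t1 j)) /= addrC is_idealDr //.
    set s1 := (X in X \in _ -> _); set s2 := (X in _ -> X \in _).
    suff -> : s1 = s2 by [].
    apply: eq_big => [t|t /andP[_ /eqP ->]]; first by rewrite inE.
    by rewrite subnn expr0 mul1r.
  apply: is_ideal_sum => // t /andP[tA ne].
  have : (0 < e t j - e t1 j)%N by rewrite subn_gt0 ltn_neqAle eq_sym ne t1min.
  case: (e t j - e t1 j)%N => // k _; rewrite exprS -mulrA mulrCA.
  exact: is_idealMr.
have [A [/set0Pn[t tA] qA eA cA]] := key N (leqnn _).
have eqA : A = [set t].
  apply/setP => t'; rewrite inE; apply/idP/eqP => [t'A|->//].
  by apply: e_inj; apply: eA.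
move: cA; rewrite eqA big_set1 /tail big_geq // mulr1.
have [icN _] := cprime (leqnn N); have [u uq] := q_unit (qA _ tA).
have icN' := idealr_closed_is_ideal icN.
by move/(is_idealMl icN' u); rewrite uq; case: icN => _ /negP.
Qed.

End ChainBound.

(** * The fiber ring *)

Section WeightPart.
Local Open Scope ring_scope.
Variables (K : fieldType) (n : nat) (w : 'I_n -> nat).
Local Notation S := {mpoly K[n]}.
Implicit Types (f g : S).

Definition wpart k f : S := mpart (fun m => wt w m == k) f.

Lemma mcoeff_wpart k f m : (wpart k f)@_m = if wt w m == k then f@_m else 0.
Proof. exact: mcoeff_mpart. Qed.

Lemma wpartD k f g : wpart k (f + g) = wpart k f + wpart k g.
Proof.
apply/mpolyP => m; rewrite mcoeffD !mcoeff_wpart mcoeffD.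
by case: ifP; rewrite ?addr0.
Qed.

Lemma wpart0 k : wpart k 0 = 0.
Proof. by apply/mpolyP => m; rewrite mcoeff_wpart mcoeff0 if_same. Qed.

Lemma wpart_sum k (T : Type) (s : seq T) (F : T -> S) :
  wpart k (\sum_(t <- s) F t) = \sum_(t <- s) wpart k (F t).
Proof. exact: (big_morph _ (wpartD k) (wpart0 k)). Qed.

Definition wt_ge k f : Prop := forall m, f@_m != 0 -> (k <= wt w m)%N.

Lemma wt_ge_rest k f : wt_ge k f -> wt_ge k.+1 (f - wpart k f).
Proof.
move=> fk m; rewrite mcoeffB mcoeff_wpart; case: ifP => [_|/negbT ne]; first by rewrite subrr eqxx.
by rewrite subr0 => /fk; lia.
Qed.

Lemma wt_ge_wpart k f : wt_ge k (wpart k f).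
Proof. by move=> m; rewrite mcoeff_wpart; case: ifP => [/eqP ->|]; rewrite ?eqxx. Qed.

Lemma wt_geM a b f g : wt_ge a f -> wt_ge b g -> wt_ge (a + b)%N (f * g).
Proof.
move=> fa gb m; rewrite -mcoeff_msupp => /msuppM_le /allpairsP[[m1 m2] /= []].
by rewrite !mcoeff_msupp => /fa h1 /gb h2 ->; rewrite wtD leq_add.
Qed.

Lemma wpart_gt k f : wt_ge k.+1 f -> wpart k f = 0.
Proof.
move=> fk; apply/mpolyP => m; rewrite mcoeff_wpart mcoeff0; case: eqP => // e.
by apply: contraPeq fk => fm /(_ _ fm); rewrite e ltnn.
Qed.

Lemma wpart_homM a b f g : wpart (a + b)%N (wpart a f * wpart b g) = wpart a f * wpart b g.
Proof.
apply/mpolyP => m; rewrite mcoeff_wpart; case: eqP => // ne; apply/esym/eqP.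
rewrite mcoeff_eq0; apply/negP => /msuppM_le /allpairsP[[m1 m2] /= []].
rewrite !mcoeff_msupp !mcoeff_wpart; case: ifP => [/eqP e1 _|_]; last by rewrite eqxx.
case: ifP => [/eqP e2 _ e|_]; last by rewrite eqxx.
by apply: ne; rewrite e wtD e1 e2.
Qed.

(** All other contributions to the product have weight above [a + b]. *)
Lemma wpartM a b f g : wt_ge a f -> wt_ge b g ->
  wpart (a + b)%N (f * g) = wpart a f * wpart b g.
Proof.
move=> fa gb.
have -> : f * g = wpart a f * wpart b g +
  ((f - wpart a f) * g + wpart a f * (g - wpart b g)) by ring.
rewrite !wpartD wpart_homM.
rewrite (@wpart_gt _ ((f - _) * g)); last first.
  by have := wt_geM (wt_ge_rest fa) gb.
rewrite (@wpart_gt _ (_ * (g - _))) ?addr0 //.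
by have := wt_geM (@wt_ge_wpart a f) (wt_ge_rest gb); rewrite addnS.
Qed.

End WeightPart.

(** * Face primes of the Rees ring and the fiber ring *)

Section Rees.
Local Open Scope quotient_scope.
Local Open Scope ring_scope.
Variables (K : fieldType) (n : nat) (B : 'X_{1..n} -> Prop).
Local Notation S := {mpoly K[n]}.
Variable I : {pred S}.
Hypothesis IB : I =i mideal B.
Implicit Types (p q r : rees I) (f g : S) (w : 'I_n -> nat).

Lemma rees_up p k m : (val p)`_k@_m != 0 -> up (mpow B k) m.
Proof.
by have /asboolP/(_ k) := valP p; rewrite (ideal_pow_mideal k IB) => /midealP; apply.
Qed.

Lemma rees_monom f k : f \in mideal (mpow B k) -> f%:P * 'X^k \in rees_pred I.
Proof.
move=> fk; apply/asboolP => j; rewrite coefCM coefXn; case: eqP => [->|_].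
  by rewrite mulr1 (ideal_pow_mideal k IB).
by rewrite mulr0; apply: ideal_gen0.
Qed.

Section Initial.
Variables (w : 'I_n -> nat) (c : nat).
Hypothesis wc : forall a, B a -> (c <= wt w a)%N.

(** The part of least possible weight. As [k * c] bounds from below the weights occurring in degree
    [k], taking this part is a ring morphism, and its kernel [face_prime] is prime. *)
Definition initial p : {poly S} := \poly_(k < size (val p)) wpart w (k * c)%N (val p)`_k.

Lemma coef_initial p k : (initial p)`_k = wpart w (k * c)%N (val p)`_k.
Proof.
rewrite coef_poly; case: ltnP => // le.
by rewrite nth_default // wpart0.
Qed.

Lemma rees_wt_ge p k : wt_ge w (k * c)%N (val p)`_k.
Proof.
move=> m /rees_up[a Ba am]; apply: leq_trans (wt_lem w am).
exact: wt_mpow_ge Ba.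
Qed.

Lemma initialD p q : initial (p + q) = initial p + initial q.
Proof. by apply/polyP => k; rewrite coefD !coef_initial raddfD coefD wpartD. Qed.

Lemma initial0 : initial 0 = 0.
Proof. by apply/polyP => k; rewrite coef_initial raddf0 !coef0 wpart0. Qed.

Lemma initialM p q : initial (p * q) = initial p * initial q.
Proof.
apply/polyP => k; rewrite coef_initial rmorphM !coefM wpart_sum.
apply: eq_bigr => i _; rewrite !coef_initial -wpartM; try exact: rees_wt_ge.
by rewrite -mulnDl subnKC // -ltnS.
Qed.

Lemma initial1 : initial 1 = 1.
Proof.
apply/polyP => k; rewrite coef_initial rmorph1 !coef1; case: eqP => [->|_]; last exact: wpart0.
apply/mpolyP => m; rewrite mcoeff_wpart mcoeff1.
by case: (m =P 0%MM) => [->|_]; rewrite ?wt0 ?eqxx ?if_same.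
Qed.

Definition face_prime : {pred rees I} := fun p => initial p == 0.

Lemma face_primeE p : (p \in face_prime) = (initial p == 0). Proof. by []. Qed.

Lemma face_primeP p :
  reflect (forall k m, wt w m = (k * c)%N -> (val p)`_k@_m = 0) (p \in face_prime).
Proof.
rewrite face_primeE; apply: (iffP eqP) => [p0 k m mk|h].
  have := congr1 (fun P : {poly S} => P`_k@_m) p0.
  by rewrite coef_initial mcoeff_wpart mk eqxx coef0 mcoeff0.
apply/polyP => k; rewrite coef_initial coef0; apply/mpolyP => m.
by rewrite mcoeff_wpart mcoeff0; case: eqP => // /h.
Qed.

Lemma is_ideal_face : is_ideal face_prime.
Proof.
split=> [|u v|a u]; rewrite !face_primeE ?initial0 // ?initialD ?initialM.
  by move=> /eqP -> /eqP ->; rewrite addr0.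
by move=> /eqP ->; rewrite mulr0.
Qed.

Lemma face_prime_prime : prime_ideal face_prime.
Proof.
split; first by apply: is_ideal_closed is_ideal_face _; rewrite face_primeE initial1 oner_eq0.
by move=> u v; rewrite !face_primeE initialM mulf_eq0.
Qed.

Hypothesis w0 : forall i, (0 < w i)%N.

Lemma wt_eq0 m : wt w m = 0%N -> m = 0%MM.
Proof.
move=> m0; apply/mnmP => i; rewrite mnm0E; have := w0 i.
have : (w i * m i <= wt w m)%N by rewrite /wt (bigD1 i) //= leq_addr.
by rewrite m0 leqn0 muln_eq0; case: (w i) => //= k /eqP.
Qed.

Lemma wt_le_eq a m : (a <= m)%MM -> wt w a = wt w m -> a = m.
Proof.
move=> am e; have := congr1 (wt w) (submK am); rewrite wtD e.
by move/(canRL (addnK _)); rewrite subnn => /wt_eq0 e0; rewrite -(submK am) e0 add0m.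
Qed.

Lemma mfiber_face : {subset mfiber I <= face_prime}.
Proof.
apply: (ideal_gen_le is_ideal_face) => p /asboolP[f /mmax_coef0 f0 pE].
apply/face_primeP => k m; rewrite pE coefC; case: eqP => [->|_]; last by rewrite mcoeff0.
by rewrite mul0n => /wt_eq0 ->.
Qed.

End Initial.

Lemma wt_mpow_face w w' c c' k a : (forall b, B b -> (c' <= wt w' b)%N) ->
  (forall b, B b -> wt w' b = c' -> wt w b = c) ->
  mpow B k a -> wt w' a = (k * c')%N -> wt w a = (k * c)%N.
Proof.
move=> wc' h; elim: k a => [|k IH] a /=; first by move=> ->; rewrite !wt0.
case=> [b [b' [Bb Bb' ->]]]; rewrite !wtD !mulSn => e.
have h1 := wc' _ Bb; have h2 := wt_mpow_ge wc' Bb'.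
by rewrite (h _ Bb) ?(IH _ Bb') //; lia.
Qed.

(** A smaller face gives a larger prime: as [w'] is positive, an exponent of least weight is itself
    a sum of bases, all of them on the face of [w']. *)
Lemma face_prime_sub w w' c c' : (forall i, (0 < w' i)%N) ->
  (forall a, B a -> (c' <= wt w' a)%N) ->
  (forall a, B a -> wt w' a = c' -> wt w a = c) ->
  {subset face_prime w c <= face_prime w' c'}.
Proof.
move=> w'0 wc' h p /face_primeP p0; apply/face_primeP => k m mk.
apply/eqP; apply: contraT => pm; have [a Ba am] := rees_up pm.
have e : a = m.
  apply: (wt_le_eq w'0 am); apply/eqP; rewrite eqn_leq wt_lem //= mk.
  exact: wt_mpow_ge Ba.
by move: pm; rewrite p0 ?eqxx // -e; apply: (wt_mpow_face wc' h Ba); rewrite e.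
Qed.

(** The element [x^a t] of the Rees ring lies in the first prime but not in the second. *)
Lemma face_prime_nsub w w' c c' : (exists a, [/\ B a, wt w a = c & wt w' a <> c']) ->
  ~ {subset face_prime w' c' <= face_prime w c}.
Proof.
case=> [a [Ba wa w'a]] sub.
have aX : ('X_[a])%:P * 'X^1 \in rees_pred I.
  by apply: rees_monom; apply/midealX/up_self/mpow1.
have coefE k : (('X_[a])%:P * 'X^1 : {poly S})`_k = if k == 1%N then 'X_[a] else 0.
  by rewrite coefCM coefXn; case: eqP; rewrite ?mulr1 ?mulr0.
have /sub/face_primeP/(_ 1%N a) : Rees aX \in face_prime w' c'.
  apply/face_primeP => k m mk; rewrite /= coefE; case: eqP => k1; last by rewrite mcoeff0.
  rewrite mcoeffX; case: eqP => // am; case: w'a.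
  by rewrite am mk k1 mul1n.
rewrite /= coefE eqxx mcoeffX eqxx mul1n => /(_ wa) /eqP.
by rewrite oner_eq0.
Qed.

Lemma pi_eq0 p : p \in mfiber I -> \pi_{ideal_quot (mfiber I)} p = 0.
Proof.
move=> pM; rewrite -[0](rmorph0 (\pi_{ideal_quot (mfiber I)})); apply/eqP.
by rewrite -Quotient.idealrBE subr0.
Qed.

(** Membership is tested on a representative; the choice is immaterial because [P] contains the
    fiber ideal. *)
Lemma quot_prime (P : {pred rees I}) : prime_ideal P -> {subset mfiber I <= P} ->
  exists Q : {pred {ideal_quot (mfiber I)}}, prime_ideal Q /\
    forall p, (\pi_{ideal_quot (mfiber I)} p \in Q) = (p \in P).
Proof.
move=> [icP prP] sub; have iP := idealr_closed_is_ideal icP.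
pose Q : {pred {ideal_quot (mfiber I)}} := fun x => repr x \in P.
have QE p : (\pi_{ideal_quot (mfiber I)} p \in Q) = (p \in P).
  have : p - repr (\pi_{ideal_quot (mfiber I)} p) \in P.
    by apply: sub; rewrite Quotient.idealrBE reprK.
  by move=> h; rewrite -{2}[p](subrK (repr (\pi_{ideal_quot (mfiber I)} p))) is_idealDr.
exists Q; split=> //; split.
  have iQ : is_ideal Q.
    split=> [|u v|a u].
    - by rewrite -[0](rmorph0 (\pi_{ideal_quot (mfiber I)})) QE is_ideal0.
    - rewrite -[u]reprK -[v]reprK -rmorphD !QE; exact: is_idealD.
    - rewrite -[u]reprK -[a]reprK -rmorphM !QE; exact: is_idealMl.
  apply: is_ideal_closed iQ _.
  by rewrite -[1](rmorph1 (\pi_{ideal_quot (mfiber I)})) QE; case: icP.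
by move=> u v; rewrite -[u]reprK -[v]reprK -rmorphM !QE; apply: prP.
Qed.

Lemma mfiber_sum (T : Type) (s : seq T) (F : T -> rees I) :
  (forall t, F t \in mfiber I) -> \sum_(t <- s) F t \in mfiber I.
Proof. by move=> FI; apply: is_ideal_sum => //; apply: is_ideal_gen. Qed.

Lemma rees_const f : f%:P \in rees_pred I.
Proof.
rewrite -[f%:P]mulr1 -(expr0 'X); apply: rees_monom; apply/midealP => m _.
by exists 0%MM => //; apply/mnm_lepP => i; rewrite mnm0E.
Qed.

Definition const f : rees I := Rees (rees_const f).

Lemma const0 : const 0 = 0.
Proof. by apply: val_inj; rewrite [RHS]rmorph0; apply: polyC0. Qed.

Section Fiber.
Variable d : nat.
Hypotheses (Bd : equigenerated d B) (d0 : (0 < d)%N).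
Let w1 : 'I_n -> nat := fun=> 1%N.

Let w1B a : B a -> (d <= wt w1 a)%N. Proof. by move/Bd <-; rewrite wt1. Qed.

(** In degree [k], an exponent of total degree above [k * d] lies strictly above a sum of [k] bases,
    so a variable splits off. With [mfiber_face], the fiber ideal equals this face prime. *)
Lemma face_prime_mfiber : {subset face_prime w1 d <= mfiber I}.
Proof.
move=> p /face_primeP p0.
have iM : is_ideal (mfiber I) := is_ideal_gen _.
have term k m a : (val p)`_k@_m != 0 -> exists2 r, r \in mfiber I & val r = (a *: 'X_[m])%:P * 'X^k.
  move=> pm; have [b Bb bm] := rees_up pm.
  have [i bi] : exists i, (b i < m i)%N.
    apply: contrapT => /forallNP h; case/eqP: pm; apply: p0.
    suff <- : b = m by rewrite /w1 wt1 (equigen_mpow Bd Bb).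
    apply/mnmP => i; apply/eqP; rewrite eqn_leq; move/mnm_lepP: bm => -> /=.
    by rewrite leqNgt; apply/negP/h.
  have mi : (0 < m i)%N by apply: leq_ltn_trans bi.
  have h : ('X_[m - U_(i)])%:P * 'X^k \in rees_pred I.
    apply: rees_monom; apply/midealX; exists b => //; apply/mnm_lepP => j.
    move/mnm_lepP: bm => /(_ j); rewrite mnmBE mnm1E; case: (i =P j) => [<-|_]; lia.
  exists (const (a *: 'X_i) * Rees h); last first.
    by rewrite rmorphM /= mulrA -polyCM -scalerAl -mpolyXD addmC mnmU.
  apply: is_idealMr => //; apply: ideal_gen_sub; apply/asboolP.
  exists (a *: 'X_i) => //; rewrite -mul_mpolyC; apply: ideal_genMl.
  by apply: ideal_gen_sub; rewrite inE; apply/existsP; exists i.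
have comp k : exists2 r, r \in mfiber I & val r = ((val p)`_k)%:P * 'X^k.
  have sub : {subset msupp (val p)`_k <= [pred m | (val p)`_k@_m != 0]}.
    by move=> m; rewrite mcoeff_msupp.
  rewrite [(val p)`_k]mpolyE; elim: (msupp _) sub => [|m s IH] sub.
    by exists 0; rewrite ?is_ideal0 // rmorph0 big_nil mul0r.
  have [|r rM rE] := IH; first by move=> x xs; apply: sub; rewrite inE xs orbT.
  have [r' r'M r'E] := term k m (val p)`_k@_m (sub _ (mem_head _ _)).
  exists (r' + r); first exact: is_idealD.
  by rewrite rmorphD /= r'E rE big_cons polyCD mulrDl.
have /choice[r rP] : forall k, exists r, r \in mfiber I /\ val r = ((val p)`_k)%:P * 'X^k.
  by move=> k; have [r] := comp k; exists r.
have -> : p = \sum_(k < size (val p)) r k.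
  apply: val_inj; rewrite raddf_sum /= -[LHS]coefK poly_def.
  by apply: eq_bigr => k _; have [_ ->] := rP k; rewrite mul_polyC.
by apply: mfiber_sum => k; case: (rP k).
Qed.

(** Setting the Rees variable to one loses nothing here: the total degree [k * d] determines [k], as
    [d] is positive. This embeds the fiber ring into [S]. *)
Definition top_part p : S := (initial w1 d p).[1].

Lemma top_partD : {morph top_part : p q / p + q}.
Proof. by move=> p q; rewrite /top_part initialD hornerD. Qed.

Lemma top_partM : {morph top_part : p q / p * q}.
Proof. by move=> p q; rewrite /top_part (initialM w1B) hornerM. Qed.

Lemma top_part0 : top_part 0 = 0.
Proof. by rewrite /top_part initial0 horner0. Qed.

Lemma top_part1 : top_part 1 = 1.
Proof. by rewrite /top_part initial1 hornerC. Qed.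

Lemma top_part_const (a : K) : top_part (const a%:MP) = a%:MP.
Proof.
rewrite /top_part; suff -> : initial w1 d (const a%:MP) = (a%:MP)%:P by rewrite hornerC.
apply/polyP => k; rewrite coef_initial /= !coefC; case: eqP => [->|_]; last exact: wpart0.
apply/mpolyP => m; rewrite mcoeff_wpart mcoeffC; case: (m =P 0%MM) => [->|_].
  by rewrite wt0 eqxx.
by rewrite mulr0 if_same.
Qed.

Lemma top_part_eq0 p : top_part p = 0 -> p \in mfiber I.
Proof.
move=> p0; apply: face_prime_mfiber; apply/face_primeP => k m mk.
have := congr1 (mcoeff m) p0; rewrite mcoeff0 /top_part horner_coef raddf_sum /=.
have e j : ((initial w1 d p)`_j * 1 ^+ j)@_m = if j == k then (val p)`_k@_m else 0.
  rewrite expr1n mulr1 coef_initial mcoeff_wpart mk eqn_pmul2r // eq_sym.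
  by case: eqP => [->|].
rewrite (eq_bigr _ (fun (j : 'I_(size (initial w1 d p))) _ => e j)) -big_mkcond /=.
case: (ltnP k (size (initial w1 d p))) => [lt|le _].
  by rewrite (big_pred1 (Ordinal lt)).
have := congr1 (mcoeff m) (nth_default 0 le); rewrite -/((initial w1 d p)`_k).
by rewrite coef_initial mcoeff_wpart mk eqxx mcoeff0.
Qed.

(** In a chain longer than [n], choose [n.+1] elements between consecutive primes. Their images in
    [S] are algebraically dependent, and the relation lifts to the fiber ring, against
    [chain_no_relation]. *)
Lemma fiber_chain_bound N (c : nat -> {pred {ideal_quot (mfiber I)}}) :
  ideal_chain c N -> (N <= n)%N.
Proof.
case=> cprime csub; rewrite leqNgt; apply/negP => nN.
have /choice[x xP] : forall i, exists x : {ideal_quot (mfiber I)}, (i < n.+1)%N ->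
    x \in c i.+1 /\ x \notin c i.
  move=> i; case: (ltnP i n.+1) => ni; last by exists 0.
  have [_ nsub] := csub i (leq_trans ni nN).
  apply: contrapT => /forallNP h; apply: nsub => x xc; apply: contrapT => /negP nx.
  by apply: (h x).
pose y i : rees I := repr (x i).
have [D [q [[e0 qe0] rel]]] := algebraic_dependence (fun i : 'I_n.+1 => top_part (y i)).
pose e (t : {ffun 'I_n.+1 -> 'I_D}) i : nat := t (inord i).
pose qq (t : {ffun 'I_n.+1 -> 'I_D}) : {ideal_quot (mfiber I)} :=
  \pi_{ideal_quot (mfiber I)} (const (q t)%:MP).
have qqV t : q t != 0 -> \pi_{ideal_quot (mfiber I)} (const (q t)^-1%:MP) * qq t = 1.
  move=> qt; rewrite /qq -rmorphM -[1](rmorph1 (\pi_{ideal_quot (mfiber I)})).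
  congr (\pi_{ideal_quot (mfiber I)} _).
  by apply: val_inj; rewrite rmorphM rmorph1 /= -polyCM -mpolyCM mulVf.
have qq0 t : q t = 0 -> qq t = 0.
  move=> qt; rewrite /qq qt mpolyC0 const0; apply: pi_eq0; apply: ideal_gen0.
have ne : \sum_t qq t * \prod_(0 <= i < n.+1) x i ^+ e t i != 0.
  apply: (@chain_no_relation _ _ n.+1 c x e qq _ _ xP).
  - by move=> i ni; apply: cprime; apply: leq_trans nN.
  - by move=> i ni; case: (csub i); rewrite ?(leq_trans ni).
  - move=> t qt; exists (\pi_{ideal_quot (mfiber I)} (const (q t)^-1%:MP)); apply: qqV.
    by apply: contraNneq qt => /qq0 ->.
  - exists e0; apply/eqP => q0; have := qqV _ qe0; rewrite q0 mulr0 => /eqP.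
    by rewrite eq_sym oner_eq0.
  - move=> t t' h; apply/ffunP => i; apply: val_inj.
    by have := h i (ltn_ord i); rewrite /e !inord_val.
case/eqP: ne.
pose r : rees I := \sum_t const (q t)%:MP * \prod_(i < n.+1) y i ^+ t i.
have rM : r \in mfiber I.
  apply: top_part_eq0; rewrite -[RHS]rel /r (big_morph _ top_partD top_part0).
  apply: eq_bigr => t _; rewrite top_partM top_part_const mul_mpolyC; congr (_ *: _).
  rewrite (big_morph _ top_partM top_part1); apply: eq_bigr => i _.
  elim: (nat_of_ord (t i)) => [|k IH]; first by rewrite !expr0 top_part1.
  by rewrite !exprS top_partM IH.
have := pi_eq0 rM.
rewrite /r rmorph_sum => {2}<-; apply: eq_bigr => t _.
rewrite rmorphM big_mkord rmorph_prod; congr (_ * _); apply: eq_bigr => i _.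
by rewrite rmorphXn /y /= reprK /e inord_val.
Qed.

End Fiber.

End Rees.

(** * Stability and analytic spread *)

Section Extrema.
Implicit Types (Q : nat -> Prop) (k N : nat).

Lemma is_min_exists Q k : Q k -> exists2 j, is_min Q j & j <= k.
Proof.
elim/ltn_ind: k => k IH Qk; case: (pselect (exists2 j, Q j & j < k)) => [[j Qj jk]|h].
  by have [i Qi ij] := IH j jk Qj; exists i => //; apply: leq_trans ij (ltnW jk).
exists k => //; split=> // j Qj; rewrite leqNgt; apply/negP => jk; apply: h.
by exists j.
Qed.

Lemma is_max_exists Q k N : Q k -> (forall j, Q j -> j <= N) -> exists2 j, is_max Q j & k <= j.
Proof.
move=> Qk QN; have [m] := ubnP (N - k); elim: m k Qk => // m IH k Qk lt.
case: (pselect (exists2 j, Q j & k < j)) => [[j Qj kj]|h].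
  have [|i Qi ji] := IH j Qj; first by have := QN _ Qj; lia.
  by exists i => //; apply: leq_trans (ltnW kj) ji.
exists k => //; split=> // j Qj; rewrite leqNgt; apply/negP => jk; apply: h.
by exists j.
Qed.

End Extrema.

Section Main.
Local Open Scope ring_scope.
Variables (K : fieldType) (n d : nat) (B : 'X_{1..n} -> Prop).
Hypotheses (Bd : equigenerated d B) (Bx : exchange B) (B0 : exists a, B a).
Hypothesis d0 : (0 < d)%N.
Variable I : {pred {mpoly K[n]}}.
Hypothesis IB : I =i mideal B.

Lemma fiber_chain_exists :
  exists c, @ideal_chain {ideal_quot (mfiber I)} c (n - #|components B|).+1.
Proof.
have [b [ws [Bb ws0 wsb wsS]]] := face_chain Bd Bx B0.
set k0 := (n - #|components B|)%N in wsb wsS *.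
(* The flag is read backwards, since primes grow as faces shrink. The last index takes weight one
   with bound zero, whose face is empty because [d] is positive. *)
pose w i : 'I_n -> nat := if (i <= k0)%N then ws (k0 - i)%N else fun=> 1%N.
pose c i : nat := if (i <= k0)%N then wt (ws (k0 - i)%N) b else 0%N.
have w0 i j : (0 < w i j)%N by rewrite /w; case: ifP.
have wc i a : B a -> (c i <= wt (w i) a)%N.
  by move=> Ba; rewrite /w /c; case: ifP => // ik; apply: wsb => //; apply: leq_subr.
have /choice[Q QP] i : exists Q : {pred {ideal_quot (mfiber I)}}, prime_ideal Q /\
    forall p, (\pi_{ideal_quot (mfiber I)}%qT p \in Q) = (p \in face_prime (I := I) (w i) (c i)).
  by apply: quot_prime; [exact: face_prime_prime (wc i)|exact: mfiber_face (wc i) (w0 i)].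
exists Q; split=> [i _|i]; first by case: (QP i).
rewrite ltnS => ik.
have [_ Qi] := QP i; have [_ Qi1] := QP i.+1.
have step : (forall a, B a -> wt (w i.+1) a = c i.+1 -> wt (w i) a = c i) /\
    exists a, [/\ B a, wt (w i) a = c i & wt (w i.+1) a <> c i.+1].
  rewrite /w /c ik; case: (ltnP i k0) => [lt|le]; last first.
    split=> [a Ba|]; first by rewrite wt1 (Bd Ba) => dz; move: d0; rewrite dz.
    by exists b; split=> //; rewrite wt1 (Bd Bb) => dz; move: d0; rewrite dz.
  have e : (k0 - i = (k0 - i.+1).+1)%N by lia.
  rewrite e; have [|h1 [a [Ba h2 h3]]] := wsS (k0 - i.+1)%N; first by lia.
  by split=> //; exists a.
split.
  move=> x; rewrite -[x]reprK Qi Qi1.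
  exact: (face_prime_sub IB (w0 i.+1) (wc i.+1) step.1).
move=> sub; apply: (face_prime_nsub IB step.2) => p.
by rewrite -Qi -Qi1; apply: sub.
Qed.

(** If no two distinct indices are adjacent, no exchange is possible, so [B] has a single element
    and [I] is principal. *)
Lemma components_ltn : ~ principal I -> (#|components B| < n)%N.
Proof.
move=> nI; rewrite ltn_neqAle -[leqRHS]card_ord max_card andbT; apply/negP => /eqP cn; apply: nI.
have all_root i : fingraph.root (adjr B) i = i.
  have : i \in components B.
    suff -> : components B = setT by rewrite inE.
    by apply/eqP; rewrite eqEcard subsetT cardsT card_ord cn /=.
  by rewrite inE => /eqP.
have adj_eq i j : adj B i j -> i = j.
  move=> ij; rewrite -(all_root i) -(all_root j); apply/eqP.
  by rewrite root_connect; [apply/connect1/asboolP|apply: adjr_sym].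
have [a Ba] := B0.
have Ba_only b : B b -> b = a.
  move=> Bb; have [|//|[i lt]] := @mnm_eq_or_lt _ b a; first by rewrite (Bd Ba) (Bd Bb).
  have [j bj Bm] := Bx Bb Ba lt.
  have ij := adj_eq _ _ (adj_move (leq_ltn_trans (leq0n _) lt) Bb Bm).
  by rewrite ij in lt; lia.
exists 'X_[a] => h; rewrite IB; apply/idP/idP.
  apply: mideal_le; first exact: is_ideal_gen.
  by move=> b /Ba_only ->; apply: ideal_gen_sub; rewrite inE.
apply: ideal_gen_le; first exact: is_ideal_mideal.
by move=> g; rewrite inE => /eqP ->; apply/midealX/up_self.
Qed.

Lemma stability_bounds : ~ principal I ->
  exists astab dstab spread : nat,
    [/\ is_astab I astab, is_dstab I dstab & analytic_spread I spread] /\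
    [/\ astab < spread, dstab < spread, astab < n & dstab < n]%N.
Proof.
move=> nI; have cn := components_ltn nI; set k0 := (n - #|components B|)%N.
have k0_gt0 : (0 < k0)%N by rewrite subn_gt0.
have IlE l : ideal_pow I l = mideal (mpow B l).
  by apply: funext => h; apply: (ideal_pow_mideal l IB).
have [astab astabP astab_le] : exists2 k, is_astab I k & (k <= k0)%N.
  apply: is_min_exists; split=> // l kl P; rewrite !IlE; split.
    exact: (associated_prime_stable Bd Bx B0).
  by apply: (associated_prime_stable Bd Bx B0) => //; apply: leq_trans kl.
have [dstab dstabP dstab_le] : exists2 k, is_dstab I k & (k <= k0)%N.
  apply: is_min_exists; split=> // l kl; exists #|components B|.-1; rewrite !IlE.
  by split; apply: (depth_mpow K Bd Bx) => //; apply: leq_trans kl.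
have [spread spreadP spread_ge] : exists2 k, analytic_spread I k & (k0.+1 <= k)%N.
  apply: (is_max_exists (N := n)); first exact: fiber_chain_exists.
  by move=> N [c]; apply: (fiber_chain_bound IB Bd).
(* At least one component exists, so [k0] is below [n]. *)
have c0 : (0 < #|components B|)%N.
  apply/card_gt0P; exists (fingraph.root (adjr B) (Ordinal cn)).
  exact: root_components.
exists astab, dstab, spread; split=> //; rewrite /k0 in astab_le dstab_le spread_ge.
by split; lia.
Qed.

End Main.

Theorem theorem4p1 (K : fieldType) (n : nat) (I : {pred {mpoly K[n]}})
    (I_proper_ideal : idealr_closed I)
    (I_polymatroidal : polymatroidal I)
    (I_not_principal : ~ principal I) :
  exists astab dstab spread : nat,
    [/\ is_astab I astab, is_dstab I dstab & analytic_spread I spread] /\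
    [/\ astab < spread, dstab < spread, astab < n & dstab < n].
Proof.
case: I_polymatroidal => B [B0 [d Bd] Bx] [IB _].
have {}IB : I =i mideal (fun a => a \in B).
  by move=> h; rewrite IB ideal_gen_monomials.
(* In degree zero the only generator would be 1, contrary to properness. *)
have d0 : 0 < d.
  have [a Ba] := B0; rewrite lt0n -(Bd _ Ba) mdeg_eq0; apply/eqP => a0.
  case: I_proper_ideal => _ /negP I1 _; apply: I1.
  by rewrite IB -mpolyX0; apply/midealX/up_self; rewrite -a0.
exact: (stability_bounds Bd Bx B0 d0 IB I_not_principal).
Qed.
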